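(* Let $n\ge 1$ be an integer, $p>1$ and $k>0$. Consider the problem \[ \Delta A - A + A^p - kA\int_{\mathbb{R}^n} A^2\,dx = 0 \ \text{ in } \mathbb{R}^n,\qquad \lim_{|x|\to\infty}A(x)=0,\qquad A(0)=\max_{x\in\mathbb{R}^n}A(x), \tag{P} \] where a solution means a positive, radially symmetric, classical solution $A:\mathbb{R}^n\to(0,\infty)$. Let $p^*(n)=\infty$ if $n=1,2$ and $p^*(n)=\frac{n+2}{n-2}$ if $n\ge 3$. For $1<p<p^*(n)$ let $A_0$ denote the unique positive radially symmetric classical solution of $\Delta A - A + A^p=0$ in $\mathbb{R}^n$, $\lim_{|x|\to\infty}A(x)=0$, $A(0)=\max A$, and set $\alpha=\int_{\mathbb{R}^n}A_0(y)^2\,dy\in(0,\infty)$. Let $e_{n,p}=\frac n2-\frac{2}{p-1}$, $f(\omega)=(\omega-1)\omega^{e_{n,p}}$ for $\omega>0$, and, when $e_{n,p}+1<0$, $\omega_{n,p}=\frac{-e_{n,p}}{-e_{n,p}-1}$. Then: \begin{enumerate} \item If $1<p<1+\frac{4}{n+2}$: (1-1) if $k>f(\omega_{n,p})/\alpha$, (P) has no solution; (1-2) if $k=f(\omega_{n,p})/\alpha$, (P) has exactly one solution; (1-3) if $0<k<f(\omega_{n,p})/\alpha$, (P) has two solutions. \item If $p=1+\frac{4}{n+2}$: (2-1) if $k\ge 1/\alpha$, (P) has no solution; (2-2) if $0<k<1/\alpha$, (P) has exactly one solution. \item If $1+\frac{4}{n+2}<p<p^*(n)$: for every $k>0$, (P)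 has exactly one solution. \item If $p\ge p^*(n)$: for every $k>0$, (P) has no solution. \end{enumerate}
   Context: The existence and uniqueness of $A_0$ for $1<p<p^*(n)$ (and that $A_0$ decays exponentially, so $\alpha$ is finite and positive) are known facts used to define $\alpha$. *)

(* Defs.v *)
From mathcomp Require Import all_boot all_order all_algebra.
From mathcomp Require Import all_classical all_reals all_analysis.
Set Implicit Arguments. Unset Strict Implicit. Unset Printing Implicit Defensive.
Import Order.TTheory GRing.Theory Num.Theory.
Import numFieldNormedType.Exports.
Local Open Scope ring_scope.
Local Open Scope classical_set_scope.

Section Defs.
Variable R : realType.

Definition evec (n : nat) (i : 'I_n) : 'rV[R]_n := delta_mx 0 i.

(* Euclidean norm on R^n (the library norm on 'rV is the max norm) *)
Definition enorm (n : nat) (x : 'rV[R]_n) : R :=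
  Num.sqrt (\sum_(i < n) x ord0 i ^+ 2).

Definition partial (n : nat) (i : 'I_n) (f : 'rV[R]_n -> R) : 'rV[R]_n -> R :=
  fun x => 'D_(evec i) f x.

Definition C2 (n : nat) (f : 'rV[R]_n -> R) : Prop :=
  [/\ continuous f,
      (forall i x, derivable f x (evec i)),
      (forall i, continuous (partial i f)),
      (forall i j x, derivable (partial i f) x (evec j)) &
      (forall i j, continuous (partial j (partial i f)))].

Definition laplacian (n : nat) (f : 'rV[R]_n -> R) (x : 'rV[R]_n) : R :=
  \sum_(i < n) partial i (partial i f) x.

(* iterated Lebesgue integral over R^n (equal to the n-dimensional Lebesgue
   integral for nonnegative measurable integrands, by Tonelli) *)
Fixpoint iter_int (n : nat) (g : seq R -> \bar R) : \bar R :=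
  match n with
  | 0 => g [::]
  | n'.+1 => (\int[@lebesgue_measure R]_(t in [set: R]) iter_int n' (fun s => g (t :: s)))%E
  end.

Definition int_sq (n : nat) (f : 'rV[R]_n -> R) : \bar R :=
  iter_int n (fun s => ((f (\row_(i < n) nth 0 s i)) ^+ 2)%:E).

Definition is_solution (n : nat) (p k : R) (A : 'rV[R]_n -> R) : Prop :=
  (forall x, 0 < A x) /\
  (forall x y, enorm x = enorm y -> A x = A y) /\
  C2 A /\
  (int_sq A < +oo)%E /\
  (forall x, laplacian A x - A x + A x `^ p - k * A x * fine (int_sq A) = 0) /\
  (forall eps : R, 0 < eps -> exists M : R, forall x, M < enorm x -> `|A x| < eps) /\
  (forall x, A x <= A 0).

Definition e_np (n : nat) (p : R) : R := n%:R / 2 - 2 / (p - 1).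
Definition f_np (n : nat) (p : R) (w : R) : R := (w - 1) * w `^ (e_np n p).
Definition omega_np (n : nat) (p : R) : R := - e_np n p / (- e_np n p - 1).

End Defs.
Arguments is_solution {R} n p k A.

(* Main.v *)
Require Import Defs.
From mathcomp Require Import all_boot all_order all_algebra.
From mathcomp Require Import all_classical all_reals all_analysis.
From mathcomp Require Import measurable_realfun ring lra.
Set Implicit Arguments. Unset Strict Implicit. Unset Printing Implicit Defensive.
Import Order.TTheory GRing.Theory Num.Theory.
Import numFieldNormedType.Exports.
Local Open Scope ring_scope.
Local Open Scope classical_set_scope.

(** With [w = 1 + k \int A^2], the dilation [A x = w^(1/(p-1)) B (w^(1/2) x)] turns
    (P) into [Delta B - B + B^p = 0]. If that equation has a single ground state
    [A0], then [\int A^2 = w^(-e) alpha], so the solutions of (P) are the dilates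
    of [A0] by the roots [w > 1] of [f w = k alpha], which calculus counts.

    Uniqueness of [A0] is proved with a generalized Pohozaev identity (Yanagida,
    Shioji-Watanabe). For the radial equation there is a quantity [J u], quadratic
    in [(u, u')] up to the term [u^(p+1)], whose derivative is a multiple of [u^2]
    only; it vanishes at infinity, and its sign is that of an explicit polynomial,
    so [J u > 0] when [p] is subcritical. Given two ground states with
    [u 0 < v 0], put [q = v / u]. Then [(J v - q^2 J u)' = - 2 q q' J u], and
    inspecting the first zero of [q'] shows that [q] decreases forever; so
    [J v - q^2 J u] increases although it vanishes at both ends. For supercritical
    [p] the function [J u] itself is monotone and vanishes at both ends. *)

(** * Real calculus *)

Section Calculus.
Context {R : realType}.
Implicit Types (f g : R -> R) (x a b : R).

Lemma drv_cst c x : is_derive x 1 (fun=> c : R) 0.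
Proof. exact: is_derive_cst. Qed.

Lemma drv_id x : is_derive x 1 (fun y : R => y) 1.
Proof. exact: is_derive_id. Qed.

Lemma drvD f g x a b : is_derive x 1 f a -> is_derive x 1 g b ->
  is_derive x 1 (fun y => f y + g y) (a + b).
Proof. exact: is_deriveD. Qed.

Lemma drvN f x a : is_derive x 1 f a -> is_derive x 1 (fun y => - f y) (- a).
Proof. exact: is_deriveN. Qed.

Lemma drvB f g x a b : is_derive x 1 f a -> is_derive x 1 g b ->
  is_derive x 1 (fun y => f y - g y) (a - b).
Proof. exact: is_deriveB. Qed.

Lemma drvM f g x a b : is_derive x 1 f a -> is_derive x 1 g b ->
  is_derive x 1 (fun y => f y * g y) (a * g x + f x * b).
Proof.
move=> fa gb; have H := is_deriveM fa gb.
by apply: is_derive_eq H _; rewrite /GRing.scale /= addrC (mulrC (g x)).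
Qed.

Lemma drvZ c f x a : is_derive x 1 f a -> is_derive x 1 (fun y => c * f y) (c * a).
Proof. by move=> fa; apply: is_derive_eq (drvM (drv_cst c x) fa) _; ring. Qed.

Lemma drv_sqr f x a : is_derive x 1 f a ->
  is_derive x 1 (fun y => f y ^+ 2) (2 * f x * a).
Proof. by move=> fa; apply: is_derive_eq (drvM fa fa) _; ring. Qed.

Lemma drv_comp f g x a b : is_derive x 1 f a -> is_derive (f x) 1 g b ->
  is_derive x 1 (fun y => g (f y)) (b * a).
Proof. by move=> fa gb; apply: is_derive1_comp. Qed.

Lemma drv_powR s f x a : 0 < f x -> is_derive x 1 f a ->
  is_derive x 1 (fun y => f y `^ s) (s * f x `^ (s - 1) * a).
Proof. by move=> fx fa; exact: (drv_comp fa (is_derive1_powR _ fx)). Qed.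

Lemma drv_inv f x a : f x != 0 -> is_derive x 1 f a ->
  is_derive x 1 (fun y => (f y)^-1) (- a / f x ^+ 2).
Proof.
move=> fx fa; have H := is_deriveV fx fa.
by apply: is_derive_eq H _; rewrite /GRing.scale /=; field.
Qed.

Lemma drv_div f g x a b : g x != 0 -> is_derive x 1 f a -> is_derive x 1 g b ->
  is_derive x 1 (fun y => f y / g y) ((a * g x - f x * b) / g x ^+ 2).
Proof.
by move=> gx fa gb; apply: is_derive_eq (drvM fa (drv_inv gx gb)) _; field.
Qed.

Lemma drv_continuous f x a : is_derive x 1 f a -> {for x, continuous f}.
Proof.
by move=> fa; apply: differentiable_continuous; apply/derivable1_diffP.
Qed.

Lemma drv_MVT f df a b : a < b ->
  (forall x, a <= x <= b -> is_derive x 1 f (df x)) ->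
  exists2 c, a < c < b & f b - f a = df c * (b - a).
Proof.
move=> ab fd; have [||c] := @MVT R f df a b ab.
- by move=> x; rewrite in_itv /= => /andP[ax xb]; apply: fd; rewrite !ltW.
- apply: derivable_within_continuous => x; rewrite in_itv /= => xab.
  by have ? := fd _ xab.
by rewrite in_itv /= => cab e; exists c.
Qed.

Lemma drv_lt f df a b : a < b ->
  (forall x, a <= x <= b -> is_derive x 1 f (df x)) ->
  (forall x, a < x < b -> 0 < df x) -> f a < f b.
Proof.
move=> ab fd dp; have [c cab e] := drv_MVT ab fd.
by rewrite -subr_gt0 e mulr_gt0 ?dp // subr_gt0.
Qed.

Lemma drv_le f df a b : a <= b ->
  (forall x, a <= x <= b -> is_derive x 1 f (df x)) ->
  (forall x, a < x < b -> 0 <= df x) -> f a <= f b.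
Proof.
rewrite le_eqVlt => /predU1P[-> //|ab] fd dp.
have [c cab e] := drv_MVT ab fd.
by rewrite -subr_ge0 e mulr_ge0 ?dp // subr_ge0 ltW.
Qed.

Lemma drv_const f a b : a <= b ->
  (forall x, a <= x <= b -> is_derive x 1 f 0) -> f a = f b.
Proof.
rewrite le_eqVlt => /predU1P[-> //|ab] fd.
have [c cab /eqP] := drv_MVT (df := fun=> 0) ab fd.
by rewrite mul0r subr_eq0 => /eqP.
Qed.

(** The detour through [x + 1] keeps the inequality strict when the limit is taken:
    [0 <= f (x + 1) < f x]. *)
Lemma decr_cvg0_gt0 f a :
  (forall x y, a <= x -> x < y -> f y < f x) ->
  f x @[x --> +oo] --> 0 -> forall x, a <= x -> 0 < f x.
Proof.
move=> fd fl x ax.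
have xy : x < x + 1 by rewrite ltrDl.
apply: le_lt_trans (fd _ _ ax xy).
apply: (cvgr_to_le fl); near=> y; apply/ltW/fd; last first.
  by near: y; apply: nbhs_pinfty_gt; rewrite num_real.
by rewrite (le_trans ax) // ltW.
Unshelve. all: by end_near. Qed.

Lemma incr_cvg0_gt0 f b :
  (forall x y, 0 < x -> x < y -> y <= b -> f x < f y) ->
  f x @[x --> 0^'+] --> 0 -> forall x, 0 < x <= b -> 0 < f x.
Proof.
move=> fi fl x /andP[x0 xb].
have x20 : 0 < x / 2 by rewrite divr_gt0.
have x2x : x / 2 < x by lra.
apply: le_lt_trans (fi _ _ x20 x2x xb).
apply: (cvgr_to_le fl); near=> y; apply/ltW/fi.
- by near: y; exact: nbhs_right_gt.
- by near: y; exact: nbhs_right_lt.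
- by rewrite (le_trans (ltW x2x)).
Unshelve. all: by end_near. Qed.

Lemma near_pinftyE (P : R -> Prop) :
  (\forall r \near +oo, P r) -> exists2 M, 0 < M & forall r, M <= r -> P r.
Proof.
move=> [M [_ MP]]; exists (`|M| + 1); first by rewrite ltr_wpDl.
move=> r Mr; apply: MP; rewrite (lt_le_trans _ Mr) //.
by rewrite (le_lt_trans (ler_norm M)) // ltrDl.
Qed.

Lemma near_right0E (P : R -> Prop) :
  (\forall r \near 0^'+, P r) -> exists2 e, 0 < e & forall r, 0 < r < e -> P r.
Proof.
move=> [e /= e0 eP]; exists e => // r /andP[r0 re]; apply: eP => //=.
by rewrite sub0r normrN gtr0_norm.
Qed.

Lemma squeeze0 {F : set_system R} {FF : Filter F} f g :
  (\forall r \near F, `|f r| <= g r) -> g r @[r --> F] --> 0 ->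
  f r @[r --> F] --> 0.
Proof.
move=> fg g0; apply/cvgr0Pnorm_le => e e0.
near=> r; apply: (@le_trans _ _ (g r)); first by near: r.
by near: r; exact: (cvgr_le _ g0).
Unshelve. all: by end_near. Qed.

Lemma cvg0_mull {F : set_system R} {FF : Filter F} c f :
  f r @[r --> F] --> 0 -> c * f r @[r --> F] --> 0.
Proof. by move=> f0; rewrite -(mulr0 c); exact: cvgMl_tmp. Qed.

Lemma cvg0_add {F : set_system R} {FF : Filter F} f g :
  f r @[r --> F] --> 0 -> g r @[r --> F] --> 0 -> f r + g r @[r --> F] --> 0.
Proof. by move=> f0 g0; rewrite -(addr0 0); exact: (cvgD f0 g0). Qed.

Lemma cvg0_mul {F : set_system R} {FF : Filter F} f g :
  f r @[r --> F] --> 0 -> g r @[r --> F] --> 0 -> f r * g r @[r --> F] --> 0.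
Proof. by move=> f0 g0; rewrite -(mulr0 0); exact: cvgM f0 g0. Qed.

Lemma cvg_near_eq {F : set_system R} {FF : Filter F} f g (l : R) :
  f r @[r --> F] --> l -> (\forall r \near F, f r = g r) ->
  g r @[r --> F] --> l.
Proof. by move=> fl fg; apply: cvg_trans fl; exact: near_eq_cvg. Qed.

Lemma is_cvg_cst {F : set_system R} {FF : Filter F} c :
  cvg ((fun=> c : R) @ F).
Proof. by apply: cvgP; exact: cvg_cst. Qed.

Lemma is_cvg_add {F : set_system R} {FF : ProperFilter F} f g :
  cvg (f @ F) -> cvg (g @ F) -> cvg ((fun r => (f r : R) + g r) @ F).
Proof. exact: is_cvgD. Qed.

Lemma is_cvg_opp {F : set_system R} {FF : ProperFilter F} f :
  cvg (f @ F) -> cvg ((fun r => - (f r : R)) @ F).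
Proof. exact: is_cvgN. Qed.

Lemma is_cvg_mul {F : set_system R} {FF : ProperFilter F} f g :
  cvg (f @ F) -> cvg (g @ F) -> cvg ((fun r => (f r : R) * g r) @ F).
Proof. exact: is_cvgM. Qed.

Lemma cvg0_mul_is_cvg {F : set_system R} {FF : ProperFilter F} f g :
  f r @[r --> F] --> 0 -> cvg (g @ F) -> f r * g r @[r --> F] --> 0.
Proof.
by move=> f0 /cvg_ex[/= l gl]; rewrite -(mul0r l); exact: (cvgM f0 gl).
Qed.

(** [z] is the infimum of the points where [f >= 0]. Negativity near the origin keeps it positive,
    and continuity excludes both signs of [f z]. *)
Lemma first_zero f e r :
  (forall x, 0 < x -> {for x, continuous f}) -> 0 < e ->
  (forall x, 0 < x < e -> f x < 0) -> 0 < r -> 0 <= f r ->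
  exists2 z, 0 < z & f z = 0 /\ (forall x, 0 < x < z -> f x < 0).
Proof.
move=> fc e0 fe r0 fr; pose S := [set x | 0 < x /\ 0 <= f x].
have Sr : S r by [].
have lbS : lbound S e.
  move=> x [x0 fx]; rewrite leNgt; apply/negP => xe.
  by have := fe x; rewrite x0 xe ltNge fx => /(_ isT).
have hS : has_inf S by split; [exists r|exists e].
pose z := inf S; have ez : e <= z by apply: lb_le_inf => //; exists r.
have z0 : 0 < z by exact: lt_le_trans ez.
have zS x : S x -> z <= x by move=> Sx; apply: ge_inf => //; exists e.
have fz x : 0 < x < z -> f x < 0.
  move=> /andP[x0 xz]; rewrite ltNge; apply/negP => fx.
  by have := zS x (conj x0 fx); rewrite leNgt xz.
exists z => //; split=> //; apply/eqP; rewrite eq_le; apply/andP; split.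
  rewrite leNgt; apply/negP => fz0.
  have /(cvgr_gt _)/(_ 0 fz0)[d /= d0 H] := fc z z0.
  pose x := Num.max (z / 2) (z - d / 2).
  have xz : x < z by rewrite gt_max; apply/andP; split; lra.
  have x0 : 0 < x by rewrite lt_max divr_gt0.
  have zx : z - d / 2 <= x by rewrite le_max lexx orbT.
  have := fz x; rewrite x0 xz => /(_ isT); apply/negP; rewrite -leNgt; apply/ltW/H.
  by rewrite /= gtr0_norm; lra.
rewrite leNgt; apply/negP => fz0.
have /(cvgr_lt _)/(_ 0 fz0)[d /= d0 H] := fc z z0.
have [x [x0 fx] xz] : exists2 x, S x & x < z + d.
  exact: inf_adherent.
have zx : z <= x by exact: zS.
have : f x < 0 by apply: H; rewrite /= ler0_norm; lra.
by rewrite ltNge fx.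
Qed.

Lemma invr_cvgy0 : (r : R)^-1 @[r --> +oo] --> 0.
Proof.
apply/cvgr0Pnorm_le => e e0; near=> r.
have r0 : e^-1 <= r by near: r; apply: nbhs_pinfty_ge; rewrite num_real.
have rp : 0 < r by rewrite (lt_le_trans _ r0) ?invr_gt0.
by rewrite gtr0_norm ?invr_gt0 // invf_ple.
Unshelve. all: by end_near. Qed.

Lemma half_cvgy : (r : R) / 2 @[r --> +oo] --> +oo.
Proof.
apply/cvgryPge => A; near=> r.
have : 2 * A <= r by near: r; apply: nbhs_pinfty_ge; rewrite num_real.
lra.
Unshelve. all: by end_near. Qed.

End Calculus.

(** * The radial equation and its decay *)

Section Radial.
Context {R : realType}.

(* [d] is the dimension minus one. Profiles are functions on the whole line (even
   extensions), and [gs_du0] encodes both [u' 0 = 0] and the existence of [u'' 0]. *)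
Record ground_state (d p : R) (u du : R -> R) : Prop := GroundState {
  gs_gt0 : forall r, 0 < u r;
  gs_max : forall r, u r <= u 0;
  gs_drv : forall r : R, is_derive r 1 u (du r);
  gs_drv2 : forall r : R, 0 < r ->
    is_derive r 1 du (u r - u r `^ p - d / r * du r);
  gs_du0 : exists l : R, du r / r @[r --> 0^'+] --> l;
  gs_lim : u r @[r --> +oo] --> (0 : R) }.

Lemma powRS (x s : R) : 0 < x -> x `^ (s + 1) = x `^ s * x.
Proof.
move=> x0; rewrite powRD; first by rewrite powRr1 // ltW.
by rewrite (gt_eqF x0) implybT.
Qed.

Lemma gs_small d p u du : 1 < p -> ground_state d p u du ->
  exists2 r0 : R, 0 < r0 & forall r : R, r0 <= r -> u r `^ p <= u r / 2.
Proof.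
move=> p1 U.
(* At this height [u^(p-1)] equals 1/2, so [u^p <= u/2] below it. *)
have e0 : 0 < (2^-1 : R) `^ (p - 1)^-1 by apply: powR_gt0; rewrite invr_gt0.
have [r0 r00 H] := near_pinftyE (cvgr_le _ (gs_lim U) _ e0).
exists r0 => // r /H ur; have u0 := gs_gt0 U r.
have -> : u r `^ p = u r `^ (p - 1) * u r by rewrite -powRS // subrK.
rewrite mulrC ler_pM2l //.
have p10 : 0 <= p - 1 by lra.
have := ge0_ler_powR p10 (ltW u0) (ltW e0) ur.
by rewrite -powRrM mulVf ?powRr1 //; lra.
Qed.

(** Where [u^p <= u/2] and [u' <= 0], the equation gives [u'' >= u/2], so [u'] is nondecreasing. The
    bound [u' <= -u/2] encodes exponential decay; monotonicity of [u'] later transfers this decay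
    from [u] to [u']. *)
Lemma gs_decay d p u du : 1 < p -> 0 <= d -> ground_state d p u du ->
  exists2 r0 : R, 0 < r0 & forall r : R, r0 <= r ->
    du r <= - (u r / 2) /\ forall s : R, r <= s -> du r <= du s.
Proof.
move=> p1 d0 U; have [r0 r00 H] := gs_small p1 U.
have rg r : r0 <= r -> 0 < r by apply: lt_le_trans.
(* [r^d u'] has derivative [r^d (u - u^p) >= 0], so a positive [u'] would stay positive and keep [u]
   away from its limit zero. *)
have du0 r1 : r0 <= r1 -> du r1 <= 0.
  move=> r01; rewrite leNgt; apply/negP => dr1.
  have dpos r : r1 <= r -> 0 < du r.
    move=> r1r; have r1p := rg _ r01; have rp := lt_le_trans r1p r1r.
    have : r1 `^ d * du r1 <= r `^ d * du r.
      pose D s := s `^ d * (u s - u s `^ p).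
      apply: (@drv_le R (fun s => s `^ d * du s) D _ _ r1r).
        move=> x /andP[r1x _]; have x0 := lt_le_trans r1p r1x.
        apply: is_derive_eq (drvM (drv_powR d x0 (drv_id x)) (gs_drv2 U x0)) _.
          have e : x `^ d = x `^ (d - 1) * x by rewrite -powRS // subrK.
        by rewrite /D e; field; rewrite gt_eqF.
      move=> x /andP[r1x _]; apply: mulr_ge0; first exact: powR_ge0.
      have := H x (le_trans r01 (ltW r1x)); have := gs_gt0 U x; lra.
    move=> le; rewrite -(pmulr_rgt0 _ (powR_gt0 d rp)).
    by apply: lt_le_trans le; rewrite mulr_gt0 ?powR_gt0.
  have : u r1 <= 0.
    apply: (cvgr_to_ge (gs_lim U)); near=> r.
    apply: (@drv_le R u du).
    - by near: r; apply: nbhs_pinfty_ge; rewrite num_real.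
    - by move=> x _; exact: gs_drv U x.
    - by move=> x /andP[/ltW/dpos/ltW].
  by rewrite leNgt (gs_gt0 U).
have ddu r : r0 <= r -> u r / 2 <= u r - u r `^ p - d / r * du r.
  move=> r0r; have := H r r0r.
  have : 0 <= d / r * - du r.
    by rewrite mulr_ge0 ?divr_ge0 ?oppr_ge0 ?du0 // ltW // rg.
  lra.
have dmon r s : r0 <= r -> r <= s -> du r <= du s.
  move=> r0r rs; apply: (drv_le rs) => x /andP[rx xs].
    exact: gs_drv2 U x (lt_le_trans (rg _ r0r) rx).
  have := ddu x (le_trans r0r (ltW rx)); have := gs_gt0 U x.
  by move: (u x - _ - _) => y; lra.
exists r0 => // r r0r; split; last by move=> s; exact: dmon.
rewrite leNgt; apply/negP => hr.
(* [h = u' + u/2] satisfies [h' >= h/2], so [h] would stay away from zero *)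
pose h s := du s + u s / 2.
pose K := h r * expR (- (r / 2)).
have K0 : 0 < K by rewrite mulr_gt0 ?expR_gt0 // /h; lra.
have hpos s : r <= s -> K * expR (s / 2) <= h s.
  move=> rs.
  have : K <= h s * expR (- (s / 2)).
    pose D x := (u x - u x `^ p - d / x * du x + du x / 2 - h x / 2)
      * expR (- (x / 2)).
    apply: (@drv_le R (fun x => h x * expR (- (x / 2))) D _ _ rs).
      move=> x /andP[rx _]; have x0 := lt_le_trans (rg _ r0r) rx.
      have dh := drvD (gs_drv2 U x0) (drvM (gs_drv U x) (drv_cst 2^-1 x)).
      have de := drv_comp (drvN (drvM (drv_id x) (drv_cst 2^-1 x))) (is_derive_expR _).
      rewrite /h; apply: is_derive_eq (drvM dh de) _.
      by rewrite /D /h; field; rewrite gt_eqF.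
    move=> x /andP[rx _]; rewrite mulr_ge0 ?expR_ge0 //.
    by have := ddu x (le_trans r0r (ltW rx)); rewrite /h; have := gs_gt0 U x; lra.
  by rewrite expRN ler_pdivlMr ?expR_gt0.
have := (gs_lim U); move/(cvgr_lt _)/(_ K K0)/near_pinftyE => [M M0 uK].
pose s := Num.max r M.
have rs : r <= s by rewrite le_max lexx.
have Ms : M <= s by rewrite le_max lexx orbT.
have := hpos s rs; have := uK s Ms; have := du0 s (le_trans r0r rs).
have e1 : 1 <= expR (s / 2).
  by rewrite -expR0 ler_expR divr_ge0 // ltW // (lt_le_trans M0).
have := ler_pM2l K0 1 (expR (s / 2)); rewrite e1 mulr1 => H1 H2 H3 H4.
have : K <= h s by apply: le_trans H4; rewrite H1.
rewrite /h; have := gs_gt0 U s; lra.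
Unshelve. all: by end_near. Qed.

(** Since [(r^t u)' = r^(t-1) (t u + r u')] and [u' <= -u/2], the product [r^t u] is nonincreasing
    beyond [2t]. Taking [t = s + 1] leaves a factor [1/r] to spare. *)
Lemma gs_powR_cvg0 d p u du s : 1 < p -> 0 <= d -> ground_state d p u du ->
  r `^ s * u r @[r --> +oo] --> 0.
Proof.
move=> p1 d0 U; have [r0 r00 H] := gs_decay p1 d0 U.
pose t := s + 1; pose r1 := Num.max r0 (2 * t).
have r1p : 0 < r1 by rewrite lt_max r00.
have mon r : r1 <= r -> r `^ t * u r <= r1 `^ t * u r1.
  move=> r1r; rewrite -lerN2.
  pose D x := - (x `^ (t - 1) * (t * u x + x * du x)).
  apply: (@drv_le R (fun x => - (x `^ t * u x)) D _ _ r1r).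
    move=> x /andP[r1x _]; have x0 := lt_le_trans r1p r1x.
    apply: is_derive_eq (drvN (drvM (drv_powR t x0 (drv_id x)) (gs_drv U x))) _.
    have e : x `^ t = x `^ (t - 1) * x by rewrite -powRS // subrK.
    by rewrite /D e; ring.
  move=> x /andP[r1x _]; rewrite oppr_ge0 mulr_ge0_le0 ?powR_ge0 //.
  have [r0x tx] : r0 <= x /\ 2 * t <= x.
    by move: (ltW r1x); rewrite ge_max => /andP[].
  have [dx _] := H x r0x; have ux := gs_gt0 U x.
  have x0 := lt_le_trans r00 r0x.
  have := ler_pM2l x0 (du x) (- (u x / 2)); rewrite dx => le1.
  have := ler_pM2r ux (2 * t) x; rewrite tx => le2.
  lra.
pose K := r1 `^ t * u r1.
apply: (@squeeze0 R _ _ _ (fun r => K * r^-1)).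
  near=> r.
  have r1r : r1 <= r by near: r; apply: nbhs_pinfty_ge; rewrite num_real.
  have r0' := lt_le_trans r1p r1r.
  rewrite ger0_norm ?mulr_ge0 ?powR_ge0 ?(ltW (gs_gt0 U r)) //.
  rewrite ler_pdivlMr // -mulrA (mulrC (u r)) mulrA -powRS //; exact: mon.
by apply: cvg0_mull; exact: invr_cvgy0.
Unshelve. all: by end_near. Qed.

(** As [u'] is nonpositive and nondecreasing, [|u' r|] is at most the mean slope of [u] over
    [[r/2, r]], hence at most [u (r/2)] once [r >= 2]. *)
Lemma gs_powRd_cvg0 d p u du s : 1 < p -> 0 <= d -> ground_state d p u du ->
  r `^ s * du r @[r --> +oo] --> 0.
Proof.
move=> p1 d0 U; have [r0 r00 H] := gs_decay p1 d0 U.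
apply: (@squeeze0 R _ _ _ (fun r => 2 `^ s * ((r / 2) `^ s * u (r / 2)))).
  near=> r.
  have r1 : 2 <= r by near: r; apply: nbhs_pinfty_ge; rewrite num_real.
  have r2 : 2 * r0 <= r by near: r; apply: nbhs_pinfty_ge; rewrite num_real.
  have r20 : r0 <= r / 2 by lra.
  have lt2 : r / 2 < r by lra.
  have [dr0 _] := H r (le_trans r20 (ltW lt2)).
  have ur := gs_gt0 U r.
  have [c /andP[c1 c2] ec] := drv_MVT lt2 (fun x _ => gs_drv U x).
  have [dc dcr] := H c (le_trans r20 (ltW c1)).
  have dm := dcr _ (ltW c2).
  rewrite mulrA -powRM //; last by lra.
  rewrite (_ : 2 * (r / 2) = r); last by field.
  rewrite normrM ger0_norm ?powR_ge0 // ler_wpM2l ?powR_ge0 //.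
  rewrite ler0_norm; last by lra.
  have : du c * (r - r / 2) <= du c * 1.
    by rewrite ler_wnM2l //; have := gs_gt0 U c; lra.
  lra.
apply: cvg0_mull.
exact: (cvg_comp _ _ half_cvgy (gs_powR_cvg0 s p1 d0 U)).
Unshelve. all: by end_near. Qed.
End Radial.

(** * The generalized Pohozaev identity *)

Section Pohozaev.
Context {R : realType}.
Implicit Types (d p : R) (u du v dv : R -> R).

(* The exponent [pexp] and the coefficient [pcoef] are the ones for which the terms
   in [u'^2], [u u'] and [u^(p+1)] disappear from the derivative of [pohozaev]. *)
Definition pexp d p := 2 * d * (p + 1) / (p + 3).
Definition pcoef d p := 2 * d / (p + 3).

Definition pohozaev d p u du (r : R) := r `^ (pexp d p - 2) *
  (r ^+ 2 * (du r ^+ 2) / 2 + pcoef d p * r * (du r * u r)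
   + pcoef d p * (d + 1 - pexp d p) / 2 * u r ^+ 2
   - r ^+ 2 * u r ^+ 2 / 2 + r ^+ 2 * u r `^ (p + 1) / (p + 1)).

Definition dpohozaev d p u (r : R) := r `^ (pexp d p - 3) *
  (pcoef d p * (d + 1 - pexp d p) * (pexp d p - 2) / 2
   - d * (p - 1) / (p + 3) * r ^+ 2) * u r ^+ 2.

Lemma pohozaev_drv d p u du (r : R) : 1 < p -> ground_state d p u du -> 0 < r ->
  is_derive r 1 (pohozaev d p u du) (dpohozaev d p u r).
Proof.
move=> p1 U r0; have dr := drv_id r; have ur := gs_gt0 U r.
have dU := gs_drv U r; have ddU := gs_drv2 U r0.
have d1 := drvM (drvM (drv_sqr dr) (drv_sqr ddU)) (drv_cst 2^-1 r).
have d2 := drvM (drvZ (pcoef d p) dr) (drvM ddU dU).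
have d3 := drvZ (pcoef d p * (d + 1 - pexp d p) / 2) (drv_sqr dU).
have d4 := drvM (drvM (drv_sqr dr) (drv_sqr dU)) (drv_cst 2^-1 r).
have d5 := drvM (drvM (drv_sqr dr) (drv_powR (p + 1) ur dU))
  (drv_cst (p + 1)^-1 r).
have Q := drvM (drv_powR (pexp d p - 2) r0 dr)
  (drvD (drvB (drvD (drvD d1 d2) d3) d4) d5).
apply: is_derive_eq Q _.
rewrite (addrK 1 p) (powRS _ ur).
have -> : pexp d p - 2 - 1 = pexp d p - 3 by ring.
have -> : r `^ (pexp d p - 2) = r `^ (pexp d p - 3) * r.
  by rewrite -powRS //; congr (_ `^ _); ring.
rewrite /dpohozaev; move: (r `^ _) (u r `^ p) => t z.
rewrite /pexp /pcoef; field.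
by rewrite !gt_eqF //; lra.
Qed.

Lemma gs_quad_cvg0 d p u du s : 1 < p -> 0 <= d -> ground_state d p u du ->
  [/\ r `^ s * du r ^+ 2 @[r --> +oo] --> 0,
      r `^ s * (du r * u r) @[r --> +oo] --> 0 &
      r `^ s * u r ^+ 2 @[r --> +oo] --> 0].
Proof.
move=> p1 d0 U.
have H1 := gs_powR_cvg0 (s / 2) p1 d0 U; have H2 := gs_powRd_cvg0 (s / 2) p1 d0 U.
have e (r : R) : 0 < r -> r `^ s = r `^ (s / 2) * r `^ (s / 2).
  move=> r0; rewrite {1}(splitr s) powRD //.
  by rewrite (gt_eqF r0) implybT.
have r0 : \forall r \near (+oo : set_system R), 0 < r.
  by apply: nbhs_pinfty_gt; rewrite num_real.
split.
- apply: (cvg_near_eq (cvg0_mul H2 H2)); near=> r.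
  by rewrite e; [ring|near: r].
- apply: (cvg_near_eq (cvg0_mul H2 H1)); near=> r.
  by rewrite e; [ring|near: r].
- apply: (cvg_near_eq (cvg0_mul H1 H1)); near=> r.
  by rewrite e; [ring|near: r].
Unshelve. all: by end_near. Qed.

Lemma pohozaev_cvgy d p u du : 1 < p -> 0 <= d -> ground_state d p u du ->
  pohozaev d p u du r @[r --> +oo] --> 0.
Proof.
move=> p1 d0 U; set m := pexp d p.
have [a1 _ a3] := gs_quad_cvg0 m p1 d0 U.
have [_ b2 _] := gs_quad_cvg0 (m - 1) p1 d0 U.
have [_ _ c3] := gs_quad_cvg0 (m - 2) p1 d0 U.
pose T (r : R) := r `^ m * u r `^ (p + 1).
have T0 : T r @[r --> +oo] --> 0.
  (* The maximum at the origin reduces the power term to a quadratic one: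
     [u^(p+1) <= u(0)^(p-1) u^2]. *)
  apply: (@squeeze0 R _ _ _ (fun r => u 0 `^ (p - 1) * (r `^ m * u r ^+ 2))).
    near=> r; have ur := gs_gt0 U r.
    rewrite ger0_norm; last by rewrite mulr_ge0 ?powR_ge0.
    have -> : T r = u r `^ (p - 1) * (r `^ m * u r ^+ 2).
      rewrite /T (_ : p + 1 = p - 1 + 1 + 1); last by ring.
      by rewrite !powRS //; ring.
    apply: ler_wpM2r; first by apply: mulr_ge0; [exact: powR_ge0|exact: sqr_ge0].
    apply: ge0_ler_powR; rewrite ?nnegrE ?(ltW (gs_gt0 U _)) ?(gs_max U) //; lra.
  exact: cvg0_mull.
apply: (@cvg_near_eq R _ _ (fun r => 2^-1 * (r `^ m * du r ^+ 2) +
  pcoef d p * (r `^ (m - 1) * (du r * u r)) +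
  pcoef d p * (d + 1 - m) / 2 * (r `^ (m - 2) * u r ^+ 2) +
  - 2^-1 * (r `^ m * u r ^+ 2) + (p + 1)^-1 * T r)).
  by do 4?[apply: cvg0_add]; exact: cvg0_mull.
near=> r.
have r0 : 0 < r by near: r; apply: nbhs_pinfty_gt; rewrite num_real.
have e1 : r `^ (m - 1) = r `^ (m - 2) * r.
  by rewrite -powRS //; congr (_ `^ _); ring.
have e2 : r `^ m = r `^ (m - 2) * r * r.
  by rewrite -!powRS //; congr (_ `^ _); ring.
rewrite /pohozaev -/m /T e1 e2.
by field; rewrite gt_eqF //; lra.
Unshelve. all: by end_near. Qed.
End Pohozaev.

(** * Sign of the Pohozaev function and uniqueness of the profile *)

Section Uniqueness.
Context {R : realType}.
Implicit Types (d p : R) (u du v dv : R -> R).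

Lemma gs_cvg_at0 d p u du : ground_state d p u du ->
  u r @[r --> 0^'+] --> u 0.
Proof. by move=> U; apply/cvg_at_right_filter/(drv_continuous (gs_drv U 0)). Qed.

Lemma id_cvg_at0 : (r : R) @[r --> 0^'+] --> (0 : R).
Proof. by apply/cvg_at_right_filter/cvg_id. Qed.

Lemma gs_dcvg_at0 d p u du : ground_state d p u du ->
  du r @[r --> 0^'+] --> 0.
Proof.
move=> U; have [l dl] := gs_du0 U.
apply: (cvg_near_eq (cvg0_mul_is_cvg id_cvg_at0 (cvgP _ dl))).
by near=> r; rewrite mulrCA divff ?mulr1 // gt_eqF.
Unshelve. all: by end_near. Qed.

Lemma gs_powR_at0 d p u du s : ground_state d p u du ->
  u r `^ s @[r --> 0^'+] --> u 0 `^ s.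
Proof.
move=> U; apply/cvg_at_right_filter.
exact: (drv_continuous (drv_powR s (gs_gt0 U 0) (gs_drv U 0))).
Qed.

(** The bracket has a finite limit and the prefactor [r^(pexp - 2)] tends to zero. *)
Lemma pohozaev_cvg_at0 d p u du : 1 < p -> ground_state d p u du ->
  2 < pexp d p -> pohozaev d p u du r @[r --> 0^'+] --> 0.
Proof.
move=> p1 U m2; apply: cvg0_mul_is_cvg.
  by apply: powR_cvg0; rewrite subr_gt0.
have cu := cvgP _ (gs_cvg_at0 U); have cdu := cvgP _ (gs_dcvg_at0 U).
have cp := cvgP _ (gs_powR_at0 (s := p + 1) U); have ci := cvgP _ id_cvg_at0.
rewrite /pohozaev.
by repeat (exact: cu || exact: cdu || exact: cp || exact: ci ||
  exact: is_cvg_cst || apply: is_cvg_add || apply: is_cvg_mul || apply: is_cvg_opp).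
Qed.

Lemma dpohozaev_lt0 d p u r : 0 < u r -> 0 < r ->
  pcoef d p * (d + 1 - pexp d p) * (pexp d p - 2) / 2
    < d * (p - 1) / (p + 3) * r ^+ 2 -> dpohozaev d p u r < 0.
Proof.
move=> ur r0 lt; rewrite pmulr_llt0 ?exprn_gt0 // pmulr_rlt0 ?powR_gt0 //.
by rewrite subr_lt0.
Qed.

Lemma pohozaev_decr d p u du (a : R) : 1 < p -> ground_state d p u du -> 0 < a ->
  (forall r, a < r -> dpohozaev d p u r < 0) ->
  forall x y, a <= x -> x < y -> pohozaev d p u du y < pohozaev d p u du x.
Proof.
move=> p1 U a0 H x y ax xy; rewrite -ltrN2.
apply: (@drv_lt R (fun r => - pohozaev d p u du r) (fun r => - dpohozaev d p u r) _ _ xy).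
  move=> z /andP[xz _]; apply: drvN; apply: pohozaev_drv => //.
  exact: lt_le_trans (lt_le_trans a0 ax) xz.
by move=> z /andP[xz _]; rewrite oppr_gt0 H // (le_lt_trans ax).
Qed.

(** The derivative has the sign of [g0 - g2 r^2] with [g2 > 0], and subcriticality amounts to
    [d + 1 - pexp > 0]. If [pexp <= 2] then [g0 <= 0] and the function decreases to zero at
    infinity. Otherwise it vanishes at both ends, increasing up to the zero [rho] of the polynomial
    and decreasing afterwards. *)
Lemma pohozaev_gt0 d p u du r : 1 < p -> 0 < d -> (d - 1) * p < d + 3 ->
  ground_state d p u du -> 0 < r -> 0 < pohozaev d p u du r.
Proof.
move=> p1 d0 sub U r0.
have cy := pohozaev_cvgy p1 (ltW d0) U.
have p30 : 0 < p + 3 by lra.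
have B0 : 0 < pcoef d p by rewrite divr_gt0 // mulr_gt0.
have nm0 : 0 < d + 1 - pexp d p.
  rewrite (_ : _ - _ = (d + 3 - (d - 1) * p) / (p + 3)).
    by rewrite divr_gt0 // subr_gt0.
  by rewrite /pexp; field; rewrite gt_eqF.
have g20 : 0 < d * (p - 1) / (p + 3) by rewrite divr_gt0 // mulr_gt0 // subr_gt0.
set g0 := pcoef d p * (d + 1 - pexp d p) * (pexp d p - 2) / 2.
set g2 := d * (p - 1) / (p + 3) in g20.
have [m2|m2] := leP (pexp d p) 2.
  have g00 : g0 <= 0.
    by rewrite /g0 pmulr_lle0 // pmulr_rle0 ?(mulr_gt0 B0 nm0) // subr_le0.
  apply: (decr_cvg0_gt0 _ cy (lexx r)); apply: pohozaev_decr => // x rx.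
  have x0 := lt_trans r0 rx.
  apply: dpohozaev_lt0; rewrite ?(gs_gt0 U) //; apply: le_lt_trans g00 _.
  by rewrite mulr_gt0 // exprn_gt0.
have g00 : 0 < g0 by rewrite /g0 divr_gt0 // mulr_gt0 ?subr_gt0 // (mulr_gt0 B0 nm0).
pose rho := Num.sqrt (g0 / g2).
have rho0 : 0 < rho by rewrite sqrtr_gt0 divr_gt0.
have rho2 : g0 = g2 * rho ^+ 2.
  rewrite /rho sqr_sqrtr; first by field; rewrite gt_eqF.
  by rewrite divr_ge0 ?ltW.
have [rr|rr] := leP rho r.
  apply: (decr_cvg0_gt0 _ cy rr); apply: pohozaev_decr => // x rx.
  have x0 := lt_trans rho0 rx.
  apply: dpohozaev_lt0; rewrite ?(gs_gt0 U) // -/g0 -/g2 rho2 ltr_pM2l //.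
  by rewrite ltr_pXn2r // ?nnegrE ltW.
apply: (incr_cvg0_gt0 (b := rho) _ (pohozaev_cvg_at0 p1 U m2)); last first.
  by rewrite r0 ltW.
move=> x y x0 xy yr.
apply: (drv_lt xy) => z /andP[xz zy].
  by apply: pohozaev_drv => //; exact: lt_le_trans xz.
have z0 := lt_trans x0 xz.
rewrite /dpohozaev -/g0 -/g2 pmulr_lgt0 ?exprn_gt0 ?(gs_gt0 U) //.
rewrite pmulr_rgt0 ?powR_gt0 // subr_gt0 rho2 ltr_pM2l //.
by rewrite ltr_pXn2r // ?nnegrE ?ltW // (lt_le_trans zy).
Qed.

(** Here [d + 1 - pexp <= 0] and [pexp > 2], so the Pohozaev function is strictly decreasing
    although it tends to zero at both ends. *)
Lemma no_supercritical_gs d p u du : 1 < p -> 0 < d -> d + 3 <= (d - 1) * p ->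
  ~ ground_state d p u du.
Proof.
move=> p1 d0 sup U.
have p30 : 0 < p + 3 by lra.
have B0 : 0 < pcoef d p by rewrite divr_gt0 // mulr_gt0.
have nm0 : d + 1 - pexp d p <= 0.
  rewrite (_ : _ - _ = (d + 3 - (d - 1) * p) / (p + 3)).
    by rewrite pmulr_lle0 ?invr_gt0 // subr_le0.
  by rewrite /pexp; field; rewrite gt_eqF.
have m2 : 2 < pexp d p.
  rewrite -subr_gt0 (_ : _ - _ = 2 * ((d - 1) * p + d - 3) / (p + 3)).
    by rewrite divr_gt0 //; lra.
  by rewrite /pexp; field; rewrite gt_eqF.
have dJ r : 0 < r -> dpohozaev d p u r < 0.
  move=> r0; apply: dpohozaev_lt0; rewrite ?(gs_gt0 U) //.
  apply: (@le_lt_trans _ _ 0).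
    by rewrite pmulr_lle0 // mulr_le0_ge0 ?pmulr_rle0 // subr_ge0 ltW.
  by rewrite mulr_gt0 ?exprn_gt0 // divr_gt0 // mulr_gt0 // subr_gt0.
have J1 : 0 < pohozaev d p u du 1.
  apply: (decr_cvg0_gt0 _ (pohozaev_cvgy p1 (ltW d0) U) (lexx 1)).
  by apply: pohozaev_decr => // x x1; apply: dJ; exact: lt_trans x1.
have : 0 < - pohozaev d p u du 1.
  apply: (@incr_cvg0_gt0 R (fun r => - pohozaev d p u du r) 1); last 2 first.
  - by rewrite -[X in _ --> X]oppr0; apply: cvgN; exact: pohozaev_cvg_at0.
  - by rewrite ltr01 lexx.
  move=> x y x0 xy _; rewrite ltrN2; apply: (pohozaev_decr p1 U x0) => // z xz.
  by apply: dJ; exact: lt_trans xz.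
by lra.
Qed.

Lemma powR_lip (p M a b : R) : 1 < p -> 0 < a -> 0 < b -> a <= M -> b <= M ->
  `|b `^ p - a `^ p| <= p * M `^ (p - 1) * `|b - a|.
Proof.
move=> p1; wlog ab : a b / a < b => [H|] a0 b0 aM bM.
  case: (ltgtP a b) => [ab|ba|->]; first exact: H.
  - by rewrite distrC (distrC b); exact: H.
  - by rewrite !subrr normr0 mulr0.
have [|c /andP[ac cb] e] := drv_MVT (f := fun x => x `^ p)
  (df := fun x => p * x `^ (p - 1)) ab.
  move=> x /andP[ax _]; apply: is_derive_eq (drv_powR p _ (drv_id x)) _.
    exact: lt_le_trans ax.
  by rewrite mulr1.
have c0 := lt_trans a0 ac.
rewrite e normrM ler_wpM2r //= ger0_norm; last by rewrite mulr_ge0 ?powR_ge0; lra.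
rewrite ler_pM2l; last by lra.
apply: ge0_ler_powR; rewrite ?nnegrE ?(ltW c0) //; first by lra.
- exact: le_trans (ltW a0) aM.
- exact: le_trans (ltW cb) bM.
Qed.

Lemma gs_eq_init d p u du v dv : 1 < p -> 0 <= d ->
  ground_state d p u du -> ground_state d p v dv -> u 0 = v 0 ->
  forall r, 0 < r -> u r = v r.
Proof.
move=> p1 d0 U V uv0.
(* [L] is a Lipschitz constant of the [p]-th power up to the common maximum. With [x], [y] the
   differences of values and slopes, the cross term [4 x y] of the derivative of [E] costs [2 E] and
   the nonlinearity costs [L E]. *)
pose L := p * u 0 `^ (p - 1); pose C := 2 + L.
have L0 : 0 <= L by rewrite mulr_ge0 ?powR_ge0; lra.
(* Gronwall on [E]; the singular term [- d / r * (du - dv)^2] has the good sign. *)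
pose E r := (u r - v r) ^+ 2 + (du r - dv r) ^+ 2.
pose G r := E r * expR (- (C * r)).
have mon (s r : R) : 0 < s -> s <= r -> G r <= G s.
  move=> s0 sr; rewrite -lerN2.
  pose x z := u z - v z; pose y z := du z - dv z.
  pose F z := u z `^ p - v z `^ p.
  pose D z := - ((2 * x z * y z + 2 * y z * (x z - F z - d / z * y z)
    - C * E z) * expR (- (C * z))).
  apply: (@drv_le R (fun z => - G z) D _ _ sr).
    move=> z /andP[sz _]; have z0 : 0 < z := lt_le_trans s0 sz.
    have h1 := drv_sqr (drvB (gs_drv U z) (gs_drv V z)).
    have h2 := drv_sqr (drvB (gs_drv2 U z0) (gs_drv2 V z0)).
    have h3 := drv_comp (drvN (drvZ C (drv_id z))) (is_derive_expR _).
    rewrite /G /E; apply: is_derive_eq (drvN (drvM (drvD h1 h2) h3)) _.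
    by rewrite /D /E /x /y /F; field; rewrite gt_eqF.
  move=> z /andP[sz _]; have z0 := lt_trans s0 sz.
  rewrite oppr_ge0 mulr_le0_ge0 ?expR_ge0 //.
  have := @powR_lip p (u 0) (v z) (u z) p1 (gs_gt0 V z) (gs_gt0 U z).
  rewrite {1}uv0 => /(_ (gs_max V z) (gs_max U z)); rewrite -/L -/(F z) -/(x z).
  have : 0 <= d / z * y z ^+ 2 by rewrite mulr_ge0 ?sqr_ge0 ?divr_ge0 // ltW.
  rewrite /E -/(x z) -/(y z) /C.
  move: (x z) (y z) (F z) => X Y Z q lip.
  have : - (2 * Y * Z) <= L * (X ^+ 2 + Y ^+ 2).
    apply: le_trans (ler_norm _) _; rewrite normrN !normrM normr_nat.
    apply: (@le_trans _ _ (2 * `|Y| * (L * `|X|))).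
      by rewrite ler_wpM2l // mulr_ge0.
    rewrite -(real_normK (num_real X)) -(real_normK (num_real Y)).
    have := mulr_ge0 L0 (sqr_ge0 (`|X| - `|Y|)); lra.
  have := sqr_ge0 (X - Y).
  by move: q; set w := d / z; nra.
have Ele r : 0 < r -> G r <= 0.
  move=> r0.
  have E0 : E s @[s --> 0^'+] --> 0.
    have cu := gs_cvg_at0 U; have cv := gs_cvg_at0 V.
    have cx : (u s - v s) @[s --> 0^'+] --> 0.
      by rewrite -[X in _ --> X](subrr (u 0)) {2}uv0; exact: cvgB cu cv.
    have cy : (du s - dv s) @[s --> 0^'+] --> 0.
      by rewrite -[X in _ --> X](subrr 0); exact: cvgB (gs_dcvg_at0 U) (gs_dcvg_at0 V).
    by apply: cvg0_add; rewrite /GRing.exp /=; exact: cvg0_mul.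
  apply: (cvgr_to_ge E0); near=> s.
  have s0 : 0 < s by near: s; exact: nbhs_right_gt.
  apply: (le_trans (mon s r s0 _)).
    by near: s; exact: nbhs_right_le.
  rewrite /G ler_piMr //; first by rewrite addr_ge0 ?sqr_ge0.
  by rewrite -expR0 ler_expR oppr_le0 mulr_ge0 ?(ltW s0) // /C; lra.
move=> r r0; have := Ele r r0.
rewrite /G pmulr_lle0 ?expR_gt0 // /E => le.
have /eqP : (u r - v r) ^+ 2 = 0.
  have := sqr_ge0 (u r - v r); have := sqr_ge0 (du r - dv r); lra.
by rewrite sqrf_eq0 subr_eq0 => /eqP.
Unshelve. all: by end_near. Qed.

(* In dimension one the Pohozaev function is the conserved energy. *)
Lemma gs_init_dim1 p u du : 1 < p -> ground_state 0 p u du ->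
  u 0 `^ (p - 1) = (p + 1) / 2.
Proof.
move=> p1 U.
have m0 : pexp 0 p = 0 by rewrite /pexp; ring.
have B0 : pcoef 0 p = 0 by rewrite /pcoef; ring.
have J0 r : 0 < r -> pohozaev 0 p u du r = 0.
  move=> r0.
  have Jc s : r <= s -> pohozaev 0 p u du s = pohozaev 0 p u du r.
    move=> rs; apply/esym/(drv_const rs) => x /andP[rx _].
    apply: is_derive_eq (pohozaev_drv p1 U (lt_le_trans r0 rx)) _.
    by rewrite /dpohozaev B0; ring.
  apply: (@cvg_unique _ _ (pohozaev 0 p u du s @[s --> +oo])).
  - exact: norm_hausdorff.
  - apply: (@cvg_near_eq R _ _ (fun=> pohozaev 0 p u du r)); first exact: cvg_cst.
    near=> s; apply/esym/Jc.
    by near: s; apply: nbhs_pinfty_ge; rewrite num_real.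
  - exact: pohozaev_cvgy.
(* For [d = 0] both [pexp] and [pcoef] vanish and the Pohozaev function reduces to this energy,
   which is therefore zero. Letting [r] tend to zero, where [u'] vanishes, determines [u 0]. *)
pose T r := du r ^+ 2 / 2 - u r ^+ 2 / 2 + u r `^ (p + 1) / (p + 1).
have T0 r : 0 < r -> T r = 0.
  move=> r0; have := J0 r r0; rewrite /pohozaev m0 B0 => /eqP.
  rewrite mulf_eq0 gt_eqF ?powR_gt0 //= => /eqP e.
  have /eqP : r ^+ 2 * T r = 0 by rewrite -[RHS]e /T; field; lra.
  by rewrite mulf_eq0 expf_eq0 gt_eqF //= => /eqP.
have Tl : T r @[r --> 0^'+] --> 0 ^+ 2 / 2 - u 0 ^+ 2 / 2 + u 0 `^ (p + 1) / (p + 1).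
  have cu := gs_cvg_at0 U; have cd := gs_dcvg_at0 U.
  apply: cvgD; first apply: cvgB.
  - by apply: cvgMr_tmp; exact: (cvgM cd cd).
  - by apply: cvgMr_tmp; exact: (cvgM cu cu).
  - by apply: cvgMr_tmp; exact: gs_powR_at0 U.
have e : 0 ^+ 2 / 2 - u 0 ^+ 2 / 2 + u 0 `^ (p + 1) / (p + 1) = 0.
  apply: (@cvg_unique _ _ (T s @[s --> 0^'+])) => //.
  apply: (@cvg_near_eq R _ _ (fun=> 0)); first exact: cvg_cst.
  by near=> s; rewrite T0.
have u0 := gs_gt0 U 0.
have e2 : u 0 `^ (p + 1) = u 0 `^ (p - 1) * u 0 ^+ 2.
  by rewrite (_ : p + 1 = p - 1 + 1 + 1) ?powRS // 1?mulrA //; ring.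
have : (u 0) ^+ 2 * (u 0 `^ (p - 1) - (p + 1) / 2) = 0.
  apply: etrans (etrans (congr1 ( *%R (p + 1)) e) (mulr0 _)).
  by rewrite e2; field; lra.
move/eqP; rewrite mulf_eq0 expf_eq0 (gt_eqF u0) /= subr_eq0 => /eqP //.
Unshelve. all: by end_near. Qed.

(** This is [u^2 (v/u)'], so its sign is the sign of the slope of the ratio. *)
Definition wronsk u du v dv (r : R) := dv r * u r - v r * du r.

Lemma wronsk_drv d p u du v dv (r : R) :
  ground_state d p u du -> ground_state d p v dv -> 0 < r ->
  is_derive r 1 (wronsk u du v dv)
    (u r `^ p * v r - v r `^ p * u r - d / r * wronsk u du v dv r).
Proof.
move=> U V r0; apply: is_derive_eq (drvB (drvM (gs_drv2 V r0) (gs_drv U r))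
  (drvM (gs_drv V r) (gs_drv2 U r0))) _.
by rewrite /wronsk; ring.
Qed.

(** [r^d wronsk] tends to zero at the origin and has derivative [r^d u v (u^(p-1) - v^(p-1))],
    negative as long as [u < v]. *)
Lemma wronsk_lt0 d p u du v dv (b : R) : 1 < p -> 0 < d ->
  ground_state d p u du -> ground_state d p v dv ->
  (forall r, 0 < r < b -> u r < v r) ->
  forall r, 0 < r <= b -> wronsk u du v dv r < 0.
Proof.
move=> p1 d0 U V uv r /andP[r0 rb].
suff : 0 < - (r `^ d * wronsk u du v dv r).
  by rewrite oppr_gt0 pmulr_rlt0 ?powR_gt0.
apply: (@incr_cvg0_gt0 R (fun r => - (r `^ d * wronsk u du v dv r)) b).
- move=> x y x0 xy yb.
  pose D z := z `^ d * (v z `^ p * u z - u z `^ p * v z).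
  apply: (@drv_lt R (fun r => - (r `^ d * wronsk u du v dv r)) D _ _ xy)
    => z /andP[xz zy].
    have z0 := lt_le_trans x0 xz.
    apply: is_derive_eq (drvN (drvM (drv_powR d z0 (drv_id z)) (wronsk_drv U V z0))) _.
    have e : z `^ d = z `^ (d - 1) * z by rewrite -powRS // subrK.
    by rewrite /D e; field; rewrite gt_eqF.
  have z0 := lt_trans x0 xz.
  have uz := gs_gt0 U z; have vz := gs_gt0 V z.
  rewrite mulr_gt0 ?powR_gt0 // subr_gt0.
  rewrite -[in X in X < _](subrK 1 p) -[in X in _ < X](subrK 1 p) !powRS //.
  rewrite -!mulrA (mulrC (v z)) ltr_pM2r ?mulr_gt0 //.
  apply: gt0_ltr_powR; rewrite ?nnegrE ?ltW //; first by rewrite subr_gt0.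
  by apply: uv; rewrite z0 (lt_le_trans zy).
- rewrite -[X in _ --> X]oppr0; apply: cvgN; apply: cvg0_mul_is_cvg.
    exact: powR_cvg0.
  apply: is_cvg_add; last apply: is_cvg_opp; apply: is_cvg_mul.
  + exact: cvgP (gs_dcvg_at0 V).
  + exact: cvgP (gs_cvg_at0 U).
  + exact: cvgP (gs_cvg_at0 V).
  + exact: cvgP (gs_dcvg_at0 U).
- by rewrite r0.
Qed.

Definition poho_gap d p u du v dv (r : R) :=
  pohozaev d p v dv r - (v r / u r) ^+ 2 * pohozaev d p u du r.

(** [dpohozaev] is the square of the profile times a factor common to [u] and [v]. The weight
    [(v/u)^2] makes these contributions cancel, leaving only the derivative of the weight. *)
Lemma poho_gap_drv d p u du v dv (r : R) : 1 < p ->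
  ground_state d p u du -> ground_state d p v dv -> 0 < r ->
  is_derive r 1 (poho_gap d p u du v dv)
    (- (2 * (v r / u r) * (wronsk u du v dv r / u r ^+ 2) * pohozaev d p u du r)).
Proof.
move=> p1 U V r0; have ur := gs_gt0 U r; have u0 : u r != 0 by rewrite gt_eqF.
apply: is_derive_eq (drvB (pohozaev_drv p1 V r0) (drvM
  (drv_sqr (drv_div u0 (gs_drv V r) (gs_drv U r))) (pohozaev_drv p1 U r0))) _.
rewrite /dpohozaev /wronsk; move: (pohozaev _ _ _ _ _) (r `^ _) => J t.
by field; rewrite !gt_eqF //; lra.
Qed.

(** No condition [pexp > 2] is imposed: the term in [r^(pexp - 2)] cancels because
    [v^2 = (v/u)^2 u^2], and the one in [r^(pexp - 1)] gains a power of [r] since [u'/r] and [v'/r]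
    converge. What remains is [r^pexp] times a convergent factor. *)
Lemma poho_gap_cvg_at0 d p u du v dv : 1 < p -> 0 < d ->
  ground_state d p u du -> ground_state d p v dv ->
  poho_gap d p u du v dv r @[r --> 0^'+] --> 0.
Proof.
move=> p1 d0 U V; set m := pexp d p.
have m0 : 0 < m by rewrite divr_gt0 ?mulr_gt0 //; lra.
pose T r := (dv r * dv r + - ((v r * (u r)^-1) * (v r * (u r)^-1) * (du r * du r))) * 2^-1
  + pcoef d p * ((v r * (u r)^-1) * ((dv r / r) * u r + - (v r * (du r / r))))
  + (v r `^ (p + 1) + - ((v r * (u r)^-1) * (v r * (u r)^-1) * u r `^ (p + 1)))
    * (p + 1)^-1.
apply: (@cvg_near_eq R _ _ (fun r => r `^ m * T r)).
  apply: cvg0_mul_is_cvg; first exact: powR_cvg0.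
  have cu := cvgP _ (gs_cvg_at0 U); have cdu := cvgP _ (gs_dcvg_at0 U).
  have cv := cvgP _ (gs_cvg_at0 V); have cdv := cvgP _ (gs_dcvg_at0 V).
  have cup := cvgP _ (gs_powR_at0 (s := p + 1) U).
  have cvp := cvgP _ (gs_powR_at0 (s := p + 1) V).
  have [lu /cvgP hu] := gs_du0 U; have [lv /cvgP hv] := gs_du0 V.
  have cui : cvg ((u r)^-1 @[r --> 0^'+]).
    by apply: cvgP (cvgV _ (gs_cvg_at0 U)); rewrite gt_eqF ?(gs_gt0 U).
  rewrite /T.
  by repeat (exact: cu || exact: cdu || exact: cup || exact: cv || exact: cdv ||
    exact: cvp || exact: hu || exact: hv || exact: cui || exact: is_cvg_cst ||
    apply: is_cvg_add || apply: is_cvg_mul || apply: is_cvg_opp).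
near=> r; have r0 : 0 < r by near: r; exact: nbhs_right_gt.
have e : r `^ m = r `^ (m - 2) * r ^+ 2.
  by rewrite expr2 mulrA -!powRS //; congr (_ `^ _); ring.
rewrite /poho_gap /pohozaev -/m e /T.
have ur := gs_gt0 U r.
by field; rewrite !gt_eqF //; lra.
Unshelve. all: by end_near. Qed.

Lemma poho_gap_incr d p u du v dv (b : R) : 1 < p -> 0 < d ->
  (d - 1) * p < d + 3 ->
  ground_state d p u du -> ground_state d p v dv ->
  (forall r, 0 < r < b -> wronsk u du v dv r < 0) ->
  forall x y, 0 < x -> x < y -> y <= b ->
    poho_gap d p u du v dv x < poho_gap d p u du v dv y.
Proof.
move=> p1 d0 sub U V W0 x y x0 xy yb; apply: (drv_lt xy) => z /andP[xz zy].
  by apply: poho_gap_drv => //; exact: lt_le_trans xz.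
have z0 := lt_trans x0 xz.
have wz : wronsk u du v dv z < 0 by apply: W0; rewrite z0 (lt_le_trans zy).
have uz := gs_gt0 U z; have vz := gs_gt0 V z.
rewrite oppr_gt0 pmulr_llt0; last exact: pohozaev_gt0.
rewrite pmulr_rlt0; last by rewrite mulr_gt0 // divr_gt0.
by rewrite pmulr_llt0 // invr_gt0 exprn_gt0.
Qed.

Lemma gs_ratio_decr d p u du v dv (b : R) :
  ground_state d p u du -> ground_state d p v dv ->
  (forall r, 0 < r < b -> wronsk u du v dv r < 0) ->
  forall x y, 0 < x -> x < y -> y <= b -> v y / u y < v x / u x.
Proof.
move=> U V W0 x y x0 xy yb; rewrite -ltrN2.
apply: (@drv_lt R (fun r => - (v r / u r))
  (fun r => - (wronsk u du v dv r / u r ^+ 2)) _ _ xy) => z /andP[xz zy].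
  have uz : u z != 0 by rewrite gt_eqF ?(gs_gt0 U).
  exact: drvN (drv_div uz (gs_drv V z) (gs_drv U z)).
have z0 := lt_trans x0 xz.
have wz : wronsk u du v dv z < 0 by apply: W0; rewrite z0 (lt_le_trans zy).
by rewrite oppr_gt0 pmulr_llt0 // invr_gt0 exprn_gt0 ?(gs_gt0 U).
Qed.

Lemma wronsk_lt0_everywhere d p u du v dv : 1 < p -> 0 < d ->
  (d - 1) * p < d + 3 ->
  ground_state d p u du -> ground_state d p v dv -> u 0 < v 0 ->
  forall r, 0 < r -> wronsk u du v dv r < 0.
Proof.
move=> p1 d0 sub U V uv0 r r0; rewrite ltNge; apply/negP => Wr.
have [e e0 uve] : exists2 e : R, 0 < e & forall r, 0 < r < e -> u r < v r.
  apply: near_right0E; near=> s; rewrite -subr_gt0; near: s.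
  apply: (cvgr_gt (v 0 - u 0)); last by rewrite subr_gt0.
  by apply: cvgB; [exact: gs_cvg_at0 V|exact: gs_cvg_at0 U].
have [||z z0 [Wz Wlt]] := @first_zero R (wronsk u du v dv) e r _ e0 _ r0 Wr.
- by move=> x x0; exact: (drv_continuous (wronsk_drv U V x0)).
- by move=> x /andP[x0 xe]; apply: (wronsk_lt0 p1 d0 U V uve); rewrite x0 ltW.
(* At the first zero of the Wronskian [poho_gap > 0] means [u z < v z], so [u < v]
   on the whole of ]0, z], where the Wronskian is then negative. *)
have Dz : 0 < poho_gap d p u du v dv z.
  apply: (@incr_cvg0_gt0 R _ z (poho_gap_incr p1 d0 sub U V Wlt)).
    exact: poho_gap_cvg_at0.
  by rewrite z0 lexx.
have uz := gs_gt0 U z; have vz := gs_gt0 V z.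
have uvz : u z < v z.
  rewrite ltNge; apply/negP => vu; move: Dz; apply/negP; rewrite -leNgt.
  (* At a zero of the Wronskian the logarithmic derivatives agree, so all quadratic terms of the gap
     cancel and only the powers [p + 1] survive. *)
  have dvz : dv z = v z * du z / u z.
    by move: Wz => /eqP; rewrite subr_eq0 => /eqP <-; rewrite mulfK // gt_eqF.
  have -> : poho_gap d p u du v dv z = z `^ (pexp d p - 2) * z ^+ 2 / (p + 1)
      * v z ^+ 2 * (v z `^ (p - 1) - u z `^ (p - 1)).
    rewrite /poho_gap /pohozaev dvz.
    have e1 : v z `^ (p + 1) = v z `^ (p - 1) * v z * v z.
      by rewrite -!powRS //; congr (_ `^ _); ring.
    have e2 : u z `^ (p + 1) = u z `^ (p - 1) * u z * u z.
      by rewrite -!powRS //; congr (_ `^ _); ring.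
    by rewrite e1 e2; field; rewrite !gt_eqF //; lra.
  rewrite pmulr_rle0; last first.
    have p0 : 0 < p + 1 by lra.
    apply: mulr_gt0; last exact: exprn_gt0.
    by apply: divr_gt0 => //; apply: mulr_gt0; [exact: powR_gt0|exact: exprn_gt0].
  rewrite subr_le0; apply: ge0_ler_powR; rewrite ?nnegrE ?(ltW uz) ?(ltW vz) //; lra.
suff : wronsk u du v dv z < 0. by rewrite Wz ltxx.
apply: (wronsk_lt0 p1 d0 U V (b := z)); last by rewrite z0 lexx.
move=> x /andP[x0 xz].
have h : 1 < v x / u x.
  apply: lt_trans (gs_ratio_decr U V Wlt x0 xz (lexx z)).
  by rewrite ltr_pdivlMr // mul1r.
by move: h; rewrite ltr_pdivlMr ?(gs_gt0 U) // mul1r.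
Unshelve. all: by end_near. Qed.

(** If [u 0 < v 0], the ratio [v/u] decreases forever, hence is bounded by its value at 1 beyond 1.
    The gap then tends to zero at infinity as well as at the origin, yet it is strictly
    increasing. *)
Lemma gs_init_le d p u du v dv : 1 < p -> 0 < d -> (d - 1) * p < d + 3 ->
  ground_state d p u du -> ground_state d p v dv -> v 0 <= u 0.
Proof.
move=> p1 d0 sub U V; rewrite leNgt; apply/negP => uv0.
have W0 := wronsk_lt0_everywhere p1 d0 sub U V uv0.
pose D := poho_gap d p u du v dv.
have Dincr x y : 0 < x -> x < y -> D x < D y.
  move=> x0 xy; apply: (poho_gap_incr p1 d0 sub U V (b := y)) => // r.
  by move=> /andP[/W0].
have D1 : 0 < D 1.
  apply: (@incr_cvg0_gt0 R _ 1 _ (poho_gap_cvg_at0 p1 d0 U V)).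
    by move=> x y x0 xy _; exact: Dincr.
  by rewrite ltr01 lexx.
have Dy : D r @[r --> +oo] --> 0.
  have cu := pohozaev_cvgy p1 (ltW d0) U; have cv := pohozaev_cvgy p1 (ltW d0) V.
  have cu0 : (v r / u r) ^+ 2 * pohozaev d p u du r @[r --> +oo] --> 0.
    apply: (@squeeze0 R _ _ _ (fun r => (v 1 / u 1) ^+ 2 * `|pohozaev d p u du r|)).
      near=> r; rewrite normrM ler_wpM2r // ger0_norm ?sqr_ge0 //.
      have r1 : 1 < r by near: r; apply: nbhs_pinfty_gt; rewrite num_real.
      have h s : 0 <= v s / u s by rewrite divr_ge0 // ltW ?(gs_gt0 U) ?(gs_gt0 V).
      rewrite ler_pXn2r ?nnegrE ?h // ltW //.
      apply: (gs_ratio_decr U V (b := r)) => // s /andP[s0 _]; exact: W0.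
    by apply: cvg0_mull; rewrite -[X in _ --> X](normr0 R); exact: cvg_norm.
  by rewrite -[X in _ --> X](subr0 0); exact: cvgB cv cu0.
have : D 1 <= 0.
  apply: (cvgr_to_ge Dy); near=> r; apply/ltW/(Dincr _ _ ltr01).
  by near: r; apply: nbhs_pinfty_gt; rewrite num_real.
by rewrite leNgt D1.
Unshelve. all: by end_near. Qed.

(** The starting values agree by comparing both ways when [d > 0]. For [d = 0] the Pohozaev function
    vanishes identically, and the explicit starting value replaces the comparison. *)
Theorem gs_unique d p u du v dv : 1 < p -> 0 <= d -> (d - 1) * p < d + 3 ->
  ground_state d p u du -> ground_state d p v dv ->
  forall r, 0 <= r -> u r = v r.
Proof.
move=> p1 d0 sub U V.
have uv0 : u 0 = v 0.
  move: d0; rewrite le_eqVlt => /predU1P[d0|d0]; last first.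
    by apply/le_anti; rewrite (gs_init_le p1 d0 sub U V) (gs_init_le p1 d0 sub V U).
  rewrite -d0 in U V; have p10 : 0 < p - 1 by lra.
  apply: (powR_injective p10); rewrite ?nnegrE ?ltW ?(gs_gt0 U) ?(gs_gt0 V) //.
  by rewrite (gs_init_dim1 p1 U) (gs_init_dim1 p1 V).
move=> r; rewrite le_eqVlt => /predU1P[<- //|].
exact: gs_eq_init p1 d0 U V uv0 r.
Qed.
End Uniqueness.

(** * From the partial differential equation to the profile *)

Section RadialReduction.
Context {R : realType}.

(** The two difference quotients are the same function. This lets the one-variable rules handle
    directional derivatives. *)
Lemma drv_lineP n (f : 'rV[R]_n -> R) (x v : 'rV[R]_n) (t df : R) :
  is_derive t 1 (fun s => f (x + s *: v)) df <-> is_derive (x + t *: v) v f df.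
Proof.
have E : (fun h : R => h^-1 *: (((fun s => f (x + s *: v)) \o shift t) (h *: 1)
    - f (x + t *: v))) =
  (fun h => h^-1 *: ((f \o shift (x + t *: v)) (h *: v) - f (x + t *: v))).
  apply/funext => h /=; congr (_ *: (f _ - _)).
  have -> : h *: (1 : R) = h by exact: mulr1.
  by rewrite scalerDl addrCA.
by split=> -[h1 h2]; split; move: h1 h2; rewrite /derivable /derive E.
Qed.

Lemma drv_val_unique (f : R -> R) (x a b : R) :
  is_derive x 1 f a -> is_derive x 1 f b -> a = b.
Proof. by move=> [_ <-] [_ <-]. Qed.

Lemma partial_line n (f : 'rV[R]_n -> R) (i : 'I_n) x (t : R) :
  (forall y, derivable f y (evec R i)) ->
  is_derive t 1 (fun s => f (x + s *: evec R i)) (partial i f (x + t *: evec R i)).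
Proof. by move=> df; apply/drv_lineP; split. Qed.

Lemma enorm_plane n (i : 'I_n.+1) (r s : R) : i != ord0 ->
  enorm (r *: evec R ord0 + s *: evec R i) = Num.sqrt (r ^+ 2 + s ^+ 2).
Proof.
move=> i0; rewrite /enorm (bigD1 ord0) //= (bigD1 i) //= big1 ?addr0 => [|j].
  rewrite !mxE !eqxx /= (negbTE i0) eq_sym (negbTE i0) /=.
  by rewrite !mulr0 !mulr1 addr0 add0r.
by move=> /andP[j0 ji]; rewrite !mxE (negbTE j0) (negbTE ji) /= !mulr0 addr0 expr0n.
Qed.

Lemma enorm_axis n (r : R) : enorm (r *: evec R (@ord0 n)) = `|r|.
Proof.
rewrite /enorm (bigD1 ord0) //= big1 ?addr0 => [|j j0].
  by rewrite !mxE !eqxx /= mulr1 sqrtr_sqr.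
by rewrite !mxE (negbTE j0) /= mulr0 expr0n.
Qed.

Lemma enorm_ge0 n (x : 'rV[R]_n) : 0 <= enorm x.
Proof. exact: sqrtr_ge0. Qed.

Section Profile.
Context (n : nat) (A : 'rV[R]_n.+1 -> R).
Context (rad : forall x y, enorm x = enorm y -> A x = A y) (A2 : C2 A).

Let e0 := evec R (@ord0 n).
Definition profile (r : R) := A (r *: e0).
Definition dprofile (r : R) := partial ord0 A (r *: e0).
Definition ddprofile (r : R) := partial ord0 (partial ord0 A) (r *: e0).

Lemma profileE x : A x = profile (enorm x).
Proof. by apply: rad; rewrite enorm_axis ger0_norm ?enorm_ge0. Qed.

Lemma profile_drv (r : R) : is_derive r 1 profile (dprofile r).
Proof.
case: A2 => _ dA _ _ _.
have := @partial_line _ A ord0 0 r (dA ord0); rewrite /dprofile add0r.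
by congr is_derive; apply/funext => s; rewrite add0r.
Qed.

Lemma dprofile_drv (r : R) : is_derive r 1 dprofile (ddprofile r).
Proof.
case: A2 => _ _ _ dA _.
have := @partial_line _ (partial ord0 A) ord0 0 r (dA ord0 ord0).
rewrite /ddprofile add0r.
by congr is_derive; apply/funext => s; rewrite add0r.
Qed.

(** Radial symmetry makes the profile even, hence its derivative odd. *)
Lemma dprofile0 : dprofile 0 = 0.
Proof.
have ev : (fun r => profile (- r)) = profile.
  by apply/funext => r; apply: rad; rewrite !enorm_axis normrN.
have h1 := drvN (drv_id (0 : R)).
have h2 := profile_drv (- 0 : R).
have := drv_comp h1 h2; rewrite ev => h.
have := drv_val_unique h (profile_drv 0); rewrite oppr0; lra.
Qed.

(** Along the line through [r *: e0] in direction [i], [A] is the profile at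
    [rho s = sqrt (r^2 + s^2)], with first derivative [dprofile (rho s) * (s / rho s)]. At [s = 0]
    only differentiating the factor [s] contributes. *)
Lemma partial_transversal (i : 'I_n.+1) (r : R) : i != ord0 -> 0 < r ->
  partial i (partial i A) (r *: e0) = dprofile r / r.
Proof.
move=> i0 r0; case: A2 => _ dA _ ddA _.
pose rho (s : R) := Num.sqrt (r ^+ 2 + s ^+ 2).
have rs0 s : 0 < r ^+ 2 + s ^+ 2 by rewrite ltr_wpDr ?sqr_ge0 ?exprn_gt0.
have rho_gt0 s : 0 < rho s by rewrite sqrtr_gt0.
have rho0 : rho 0 = r by rewrite /rho expr0n addr0 sqrtr_sqr gtr0_norm.
have drho (s : R) : is_derive s 1 rho (s / rho s).
  have h := drv_comp (drvD (drv_cst (r ^+ 2) s) (drv_sqr (drv_id s)))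
    (is_derive1_sqrt (rs0 s)).
  apply: is_derive_eq h _; rewrite -/(rho s); field; by rewrite gt_eqF.
have Aline s : A (r *: e0 + s *: evec R i) = profile (rho s).
  by rewrite profileE enorm_plane.
have first s : partial i A (r *: e0 + s *: evec R i) = dprofile (rho s) * (s / rho s).
  apply: (drv_val_unique (partial_line _ _ (dA i))).
  have -> : (fun s => A (r *: e0 + s *: evec R i)) = (fun s => profile (rho s)).
    by apply/funext.
  exact: drv_comp (drho s) (profile_drv _).
have h1 := @partial_line _ (partial i A) i (r *: e0) 0 (ddA i i).
rewrite scale0r addr0 in h1.
have E : (fun s => partial i A (r *: e0 + s *: evec R i)) =
    (fun s => dprofile (rho s) * (s / rho s)) by apply/funext.
rewrite E in h1; apply: (drv_val_unique h1).
have rn : rho 0 != 0 by rewrite gt_eqF.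
have h2 := drvM (drv_comp (drho 0) (dprofile_drv _))
  (drv_div rn (drv_id 0) (drho 0)).
apply: is_derive_eq h2 _; rewrite rho0.
by field; rewrite gt_eqF.
Qed.

(** In ambient dimension [n.+1] there are [n] transversal directions with equal contributions; hence
    [d = n] in the radial equation. *)
Lemma laplacian_profile (r : R) : 0 < r ->
  laplacian A (r *: e0) = ddprofile r + n%:R / r * dprofile r.
Proof.
move=> r0; rewrite /laplacian (bigD1 ord0) //=; congr (_ + _).
rewrite (eq_bigr (fun=> dprofile r / r)); last first.
  by move=> i i0; exact: partial_transversal.
rewrite sumr_const cardC1 card_ord /= -[RHS]mulrAC -mulrA mulr_natl.
by rewrite mulrC.
Qed.
End Profile.

Lemma solution_ground_state n p (A : 'rV[R]_n.+1 -> R) :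
  is_solution n.+1 p 0 A -> ground_state n%:R p (profile A) (dprofile A).
Proof.
move=> [A0 [rad [A2 [_ [eqA [limA maxA]]]]]]; split.
- by move=> r; exact: A0.
- by move=> r; rewrite /profile scale0r; exact: maxA.
- exact: profile_drv.
- move=> r r0; apply: is_derive_eq (dprofile_drv A2 r) _.
  have := eqA (r *: evec R ord0); rewrite (laplacian_profile rad A2 r0) !mul0r.
  rewrite -/(profile A r); lra.
(* Because [dprofile] vanishes at zero, [dprofile r / r] is its difference quotient there. *)
- exists (ddprofile A 0).
  have [+ <-] := dprofile_drv A2 0.
  rewrite /derivable => h; apply: (cvg_near_eq (f := fun h => h^-1 *:
      ((dprofile A \o shift 0) (h *: 1) - dprofile A 0))).
    exact: cvg_dnbhs_at_right h.
  near=> r; rewrite /= addr0 (dprofile0 rad A2) subr0.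
  have -> : r *: (1 : R) = r by exact: mulr1.
  by rewrite mulrC.
- apply/cvgr0Pnorm_lt => e /limA[M HM]; near=> r.
  have r0 : 0 < r by near: r; apply: nbhs_pinfty_gt; rewrite num_real.
  apply: HM; rewrite enorm_axis gtr0_norm //.
  by near: r; apply: nbhs_pinfty_gt; rewrite num_real.
Unshelve. all: by end_near. Qed.

Lemma solution0_unique n p (A A' : 'rV[R]_n.+1 -> R) : 1 < p ->
  (n%:R - 1) * p < n%:R + 3 ->
  is_solution n.+1 p 0 A -> is_solution n.+1 p 0 A' -> A = A'.
Proof.
move=> p1 sub S S'; apply/funext => x.
have [_ [rad _]] := S; have [_ [rad' _]] := S'.
rewrite (profileE rad) (profileE rad').
apply: (gs_unique p1 (ler0n _ _) sub (solution_ground_state S)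
  (solution_ground_state S')).
exact: enorm_ge0.
Qed.

Lemma no_supercritical_solution n p (A : 'rV[R]_n.+1 -> R) : 1 < p ->
  n%:R + 3 <= (n%:R - 1) * p -> ~ is_solution n.+1 p 0 A.
Proof.
move=> p1 sup S.
have n0 : 0 < n%:R :> R.
  by case: n sup {A S} => [|n] sup; [move: sup; lra|rewrite ltr0n].
exact: no_supercritical_gs p1 n0 sup (solution_ground_state S).
Qed.
End RadialReduction.

(** * Dilations and the integral *)

Section Dilation.
Context {R : realType}.
Local Open Scope ereal_scope.
Import HBNNSimple.
Notation mu := (@lebesgue_measure R).

(* [f] need not be measurable: the library defines the integral of a
   nonnegative function as the supremum over the simple functions below it. *)
Lemma ge0_integral_mono (f g : R -> \bar R) : (forall x, 0 <= f x) ->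
  (forall x, f x <= g x) -> \int[mu]_x f x <= \int[mu]_x g x.
Proof.
move=> f0 fg; have g0 x : 0 <= g x := le_trans (f0 x) (fg x).
rewrite !ge0_integralTE //=; apply: le_ereal_sup => _ [h hf <-].
by exists h => // x; exact: le_trans (hf x) (fg x).
Qed.

(** An upper bound need only be checked on measurable minorants, for which the change of variables
    is available. *)
Lemma ge0_integral_sup (f : R -> \bar R) (M : \bar R) : (forall x, 0 <= f x) ->
  (forall h : R -> R, measurable_fun setT h -> (forall x, (0 <= h x)%R) ->
    (forall x, (h x)%:E <= f x) -> \int[mu]_x (h x)%:E <= M) ->
  \int[mu]_x f x <= M.
Proof.
move=> f0 H; rewrite ge0_integralTE //=; apply: ge_ereal_sup => _ [h hf <-].
have := integral_nnsfun mu measurableT h.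
rewrite patch_setT => <-; apply: H => //.
exact: (@measurable_funP _ _ _ _ _ h).
Qed.

Lemma measurable_dilation (l : R) : measurable_fun setT (fun x : R => l * x)%R.
Proof. exact: mulrl_measurable. Qed.

(** Lebesgue measure is [l] times its image under the dilation: the two agree on half-open
    intervals, which determine it. *)
Lemma integral_dilation_measurable (l : R) (h : R -> R) : (0 < l)%R ->
  measurable_fun setT h -> (forall x, (0 <= h x)%R) ->
  \int[mu]_x (h x)%:E = l%:E * \int[mu]_x (h (l * x)%R)%:E.
Proof.
move=> l0 mh h0.
pose phi := (fun x => l * x)%R : R -> measurableTypeR R.
have mphi : measurable_fun setT phi by exact: measurable_dilation.
have l0' : (0 <= l)%R by exact: ltW.
pose P : {measure set (measurableTypeR R) -> \bar R} :=
  measure_function_pushforward__canonical__measure_function_Measure mu mphi.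
transitivity (\int[mscale (NngNum l0') P]_x (h x)%:E).
  apply: eq_measure_integral => A mA _.
  apply: lebesgue_measure_unique => // _ [[a b]] _ <-.
  change (mu `]a, b]%classic = l%:E * mu (phi @^-1` `]a, b]%classic)).
  have -> : phi @^-1` `]a, b]%classic = `](a / l)%R, (b / l)%R]%classic.
    apply/seteqP; split=> x /=; rewrite !in_itv /= /phi;
    by rewrite ltr_pdivrMr // ler_pdivlMr // (mulrC x).
  rewrite !lebesgue_measure_itv /= !lte_fin ltr_pM2r ?invr_gt0 //.
  case: ifP => _; last by rewrite mule0.
  by rewrite -!EFinB -EFinM; congr (_%:E); field; rewrite gt_eqF.
rewrite ge0_integral_mscale //=.
- rewrite ge0_integral_pushforward //=.
  + by apply: measurableT_comp mh.
  + by move=> x _; rewrite lee_fin.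
- exact: measurableT_comp.
- by move=> x _; rewrite lee_fin.
Qed.

Lemma ge0_integral_dilation_le (l : R) (f : R -> \bar R) : (0 < l)%R ->
  (forall x, 0 <= f x) ->
  \int[mu]_x f (l * x)%R <= l^-1%:E * \int[mu]_x f x.
Proof.
move=> l0 f0; apply: ge0_integral_sup => // h mh h0 hf.
have li0 : (0 < l^-1)%R by rewrite invr_gt0.
rewrite (integral_dilation_measurable li0 mh h0) lee_pmul2l ?lte_fin //.
apply: ge0_integral_mono => x; first by rewrite lee_fin.
apply: le_trans (hf _) _; rewrite mulrA divff ?mul1r // gt_eqF //.
Qed.

(** The reverse inequality is the previous one applied to the inverse dilation. *)
Lemma ge0_integral_dilation (l : R) (f : R -> \bar R) : (0 < l)%R ->
  (forall x, 0 <= f x) ->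
  \int[mu]_x f (l * x)%R = l^-1%:E * \int[mu]_x f x.
Proof.
move=> l0 f0; apply/le_anti; rewrite ge0_integral_dilation_le //=.
have li0 : (0 < l^-1)%R by rewrite invr_gt0.
have := @ge0_integral_dilation_le _ (fun x => f (l * x)%R) li0 (fun x => f0 _).
rewrite invrK => H.
have E : (fun x => f (l * (l^-1 * x))%R) = f.
  by apply/funext => x; rewrite mulrA divff ?mul1r // gt_eqF.
rewrite E in H.
rewrite -(@lee_pmul2l _ l%:E) ?lte_fin // muleA -EFinM divff ?gt_eqF // mul1e //.
Qed.

(** One inequality follows from measurable minorants; applying it to [c^-1] gives the other. *)
Lemma ge0_integral_scale (c : R) (f : R -> \bar R) : (0 < c)%R ->
  (forall x, 0 <= f x) -> \int[mu]_x (c%:E * f x) = c%:E * \int[mu]_x f x.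
Proof.
have le (b : R) (g : R -> \bar R) : (0 < b)%R -> (forall x, 0 <= g x) ->
    b%:E * \int[mu]_x g x <= \int[mu]_x (b%:E * g x).
  move=> b0 g0; rewrite -lee_pdivlMl //; apply: ge0_integral_sup => // h mh h0 hg.
  rewrite lee_pdivlMl // -ge0_integralZl //=.
  - apply: ge0_integral_mono => x; first by rewrite mule_ge0 ?lee_fin // ltW.
    by rewrite lee_pmul2l ?lte_fin.
  - exact: measurableT_comp.
  - by move=> x _; rewrite lee_fin.
  - by rewrite lee_fin ltW.
move=> c0 f0; apply/le_anti; rewrite le // andbT.
have ci0 : (0 < c^-1)%R by rewrite invr_gt0.
have cf0 x : 0 <= c%:E * f x by rewrite mule_ge0 // lee_fin ltW.
have := le _ _ ci0 cf0; rewrite lee_pdivrMl // => H; apply: le_trans H _.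
rewrite lee_pmul2l ?lte_fin //; apply: ge0_integral_mono => x.
  by rewrite mule_ge0 // lee_fin ltW.
by rewrite muleA -EFinM mulVf ?gt_eqF // mul1e.
Qed.
End Dilation.

(** * Iterated integrals over [R^n]: scaling and positivity *)

Section SquareIntegral.
Context {R : realType}.
Local Open Scope ereal_scope.
Notation mu := (@lebesgue_measure R).

Lemma iter_int_ge0 n (g : seq R -> \bar R) : (forall s, 0 <= g s) ->
  0 <= iter_int n g.
Proof.
elim: n g => [|n IH] g g0 /=; first exact: g0.
by apply: integral_ge0 => x _; apply: IH.
Qed.

(** Each coordinate yields a factor [l^-1]. The inner integral is treated as an arbitrary
    nonnegative function, so no measurability has to be tracked. *)
Lemma iter_int_dilation n (c l : R) (g : seq R -> \bar R) : (0 < c)%R ->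
  (0 < l)%R -> (forall s, 0 <= g s) ->
  iter_int n (fun s => c%:E * g [seq (l * x)%R | x <- s]) =
  (c * l^-1 ^+ n)%:E * iter_int n g.
Proof.
move=> c0 l0; elim: n g => [|n IH] g g0 /=; first by rewrite expr0 mulr1.
under eq_integral => t _.
  rewrite (IH (fun s => g (l * t :: s)%R)) //.
  over.
have cl : (0 < c * l^-1 ^+ n)%R by rewrite mulr_gt0 // exprn_gt0 // invr_gt0.
rewrite ge0_integral_scale //; last by move=> x; exact: iter_int_ge0.
rewrite (@ge0_integral_dilation R l (fun t => iter_int n (fun s => g (t :: s)))) //.
  by rewrite muleA -EFinM -mulrA exprSr.
by move=> x; exact: iter_int_ge0.
Qed.

(** The integral over the unit cube, of volume one, already gives the bound. *)
Lemma iter_int_ge n (g : seq R -> \bar R) (a : R) : (0 <= a)%R ->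
  (forall s, 0 <= g s) ->
  (forall s : seq R, size s = n -> all (fun x : R => 0 <= x <= 1)%R s -> a%:E <= g s) ->
  a%:E <= iter_int n g.
Proof.
move=> a0; elim: n g => [|n IH] g g0 ga /=; first exact: ga.
pose I01 := `[0%R, 1%R]%classic : set (measurableTypeR R).
have mI : mu I01 = 1.
  by rewrite /I01 lebesgue_measure_itv /= lte_fin ltr01 sube0.
have -> : a%:E = \int[mu]_x (a%:E * (\1_I01 x)%:E).
  rewrite ge0_integralZl //=.
  - rewrite integral_indic ?setIT; last exact: measurable_itv.
    by rewrite -[LHS]mule1; congr (_ * _); exact/esym.
  - exact: measurableT.
  - apply/measurable_EFinP; apply: measurable_indic; exact: measurable_itv.
apply: ge0_integral_mono => x; first by rewrite mule_ge0 // lee_fin.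
rewrite indicE; have [|_] := boolP (x \in I01); last first.
  by rewrite mule0; exact: iter_int_ge0.
rewrite inE mule1 => x01; apply: IH => // s ss s01; apply: ga; first by rewrite /= ss.
by rewrite /= s01 andbT; move: x01; rewrite /I01 /= in_itv.
Qed.

Lemma int_sq_dilation n (c l : R) (A : 'rV[R]_n -> R) : (0 < c)%R -> (0 < l)%R ->
  int_sq (fun x => c * A (l *: x))%R = (c ^+ 2 * l^-1 ^+ n)%:E * int_sq A.
Proof.
move=> c0 l0; rewrite /int_sq -iter_int_dilation ?exprn_gt0 //; last first.
  by move=> s; rewrite lee_fin sqr_ge0.
congr iter_int; apply/funext => s; rewrite -EFinM -exprMn; congr ((c * A _) ^+ 2)%:E.
apply/rowP => i; rewrite !mxE.
(* Beyond the end of [s] both entries are the default zero, which the dilation fixes. *)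
have [si|si] := ltnP i (size s); first by rewrite (nth_map 0%R).
by rewrite !nth_default ?size_map // mulr0.
Qed.
Lemma int_sq_ge0 n (A : 'rV[R]_n -> R) : 0 <= int_sq A.
Proof. by apply: iter_int_ge0 => s; rewrite lee_fin sqr_ge0. Qed.

(** On the compact unit cube [A] has a positive minimum, whose square bounds the integral from
    below. *)
Lemma int_sq_gt0 n (A : 'rV[R]_n -> R) : continuous A -> (forall x, 0 < A x)%R ->
  0 < int_sq A.
Proof.
move=> cA A0; pose K := [set v : 'rV[R]_n | forall i, `[0%R, 1%R]%classic (v ord0 i)].
have cK : compact K.
  by apply: (@rV_compact R n (fun=> `[0%R, 1%R]%classic)) => i; exact: segment_compact.
have K0 : K !=set0.
  by exists 0%R => i /=; rewrite mxE in_itv /= lexx ler01.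
have [c _ minA] := EVT_min_rV K0 cK (continuous_subspaceT cA).
apply: (@lt_le_trans _ _ (A c ^+ 2)%:E); first by rewrite lte_fin exprn_gt0.
apply: iter_int_ge; first exact: sqr_ge0.
  by move=> s; rewrite lee_fin sqr_ge0.
move=> s ss s01; rewrite lee_fin ler_pXn2r ?nnegrE ?(ltW (A0 _)) // minA //.
rewrite inE => i /=; rewrite mxE in_itv /=.
by apply: (allP s01); rewrite mem_nth // ss.
Qed.
End SquareIntegral.

(** * Dilations of solutions *)

Section Scaling.
Context {R : realType}.

Definition dilate n (c l : R) (A : 'rV[R]_n -> R) (x : 'rV[R]_n) := c * A (l *: x).

Lemma dilate_drv n (c l : R) (f : 'rV[R]_n -> R) (x v : 'rV[R]_n) :
  derivable f (l *: x) v ->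
  is_derive x v (dilate c l f) (c * l * 'D_v f (l *: x)).
Proof.
move=> df.
have h : is_derive (l *: x + (l * 0) *: v) v f ('D_v f (l *: x)).
  by rewrite mulr0 scale0r addr0; split.
have /drv_lineP h1 := h.
have h2 := drvZ c (drv_comp (drvZ l (drv_id (0 : R))) h1).
have -> : x = x + (0 : R) *: v by rewrite scale0r addr0.
apply/drv_lineP; rewrite scale0r addr0.
have -> : (fun s => dilate c l f (x + s *: v)) =
    (fun s => c * f (l *: x + (l * s) *: v)).
  by apply/funext => s; rewrite /dilate scalerDr scalerA.
by apply: is_derive_eq h2 _; ring.
Qed.

Lemma partial_dilate n (c l : R) (i : 'I_n) (f : 'rV[R]_n -> R) :
  (forall x, derivable f x (evec R i)) ->
  partial i (dilate c l f) = dilate (c * l) l (partial i f).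
Proof.
by move=> df; apply/funext => x; have [_ e] := dilate_drv c (df (l *: x)).
Qed.

Lemma continuous_dilate n (c l : R) (f : 'rV[R]_n -> R) :
  continuous f -> continuous (dilate c l f).
Proof.
move=> cf x; have h : {for x, continuous (f \o (fun y => l *: y))}.
  by apply: continuous_comp; [exact: scaler_continuous|exact: cf].
exact: cvgMl_tmp h.
Qed.

Lemma C2_dilate n (c l : R) (f : 'rV[R]_n -> R) : C2 f -> C2 (dilate c l f).
Proof.
move=> [cf df cdf ddf cddf]; split.
- exact: continuous_dilate.
- by move=> i x; have [] := dilate_drv c (df i (l *: x)).
- by move=> i; rewrite partial_dilate //; exact: continuous_dilate.
- move=> i j x; rewrite partial_dilate //.
  by have [] := dilate_drv (c * l) (ddf i j (l *: x)).
- move=> i j; rewrite partial_dilate // partial_dilate //.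
  exact: continuous_dilate.
Qed.

Lemma laplacian_dilate n (c l : R) (f : 'rV[R]_n -> R) x : C2 f ->
  laplacian (dilate c l f) x = c * l ^+ 2 * laplacian f (l *: x).
Proof.
move=> [cf df cdf ddf cddf]; rewrite /laplacian mulr_sumr; apply: eq_bigr => i _.
by rewrite !partial_dilate // /dilate; ring.
Qed.

Lemma enormZ n (l : R) (x : 'rV[R]_n) : 0 <= l -> enorm (l *: x) = l * enorm x.
Proof.
move=> l0; rewrite /enorm -[X in _ = X * _](ger0_norm l0) -sqrtr_sqr -sqrtrM ?sqr_ge0 //.
by congr Num.sqrt; rewrite mulr_sumr; apply: eq_bigr => i _; rewrite !mxE exprMn.
Qed.

(** The condition [c^p = c l^2] gives the Laplacian and the power term the same factor. The last
    hypothesis then matches the coefficients of the linear term, nonlocal part included. *)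
Lemma is_solution_dilate n (p k k' c l : R) (A : 'rV[R]_n -> R) :
  0 < c -> 0 < l -> c `^ p = c * l ^+ 2 -> is_solution n p k A ->
  l ^+ 2 * (1 + k * fine (int_sq A)) =
    1 + k' * (c ^+ 2 * l^-1 ^+ n * fine (int_sq A)) ->
  is_solution n p k' (dilate c l A).
Proof.
move=> c0 l0 cl [A0 [rad [A2 [fin [eqA [lim max]]]]]] e.
have finA : int_sq A \is a fin_num by rewrite ge0_fin_numE ?int_sq_ge0.
have Ieq := int_sq_dilation A c0 l0; rewrite -/(dilate c l A) in Ieq.
split; first by move=> x; rewrite mulr_gt0.
split; first by move=> x y xy; congr (c * _); apply: rad; rewrite !enormZ ?ltW // xy.
split; first exact: C2_dilate.
split; first by rewrite Ieq -(fineK finA) -EFinM ltry.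
split.
  move=> x; rewrite Ieq -(fineK finA) -EFinM /= laplacian_dilate // /dilate.
  rewrite powRM ?(ltW c0) ?(ltW (A0 _)) // cl.
  have := eqA (l *: x); set a := A (l *: x); set L := laplacian A (l *: x).
  set I := fine (int_sq A) in e *; move=> eqx.
  have -> : L = a + k * a * I - a `^ p by lra.
  rewrite (_ : k' * (c * a) * (_ * I) = c * a * (k' * (c ^+ 2 * l^-1 ^+ n * I))).
    have -> : k' * (c ^+ 2 * l^-1 ^+ n * I) = l ^+ 2 * (1 + k * I) - 1 by lra.
    by ring.
  by ring.
split; last first.
  by move=> x; rewrite /dilate scaler0 ler_pM2l.
move=> eps eps0; have [|M HM] := lim (eps / c); first by rewrite divr_gt0.
exists (M / l) => x; rewrite ltr_pdivrMr // mulrC -enormZ ?ltW // => /HM.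
by rewrite /dilate normrM gtr0_norm // ltr_pdivlMr // mulrC.
Qed.

(** These exponents are the solution of [l^2 = w] and [c^(p-1) = w]. *)
Definition rescale n (p w : R) (A : 'rV[R]_n -> R) :=
  dilate (w `^ (p - 1)^-1) (w `^ 2^-1) A.

Lemma powR_half_sqr (w : R) : 0 < w -> (w `^ 2^-1) ^+ 2 = w.
Proof.
move=> w0; rewrite expr2 -powRD ?(gt_eqF w0) ?implybT //.
by rewrite (_ : 2^-1 + 2^-1 = 1) ?powRr1 ?ltW //; field.
Qed.

Lemma rescale_coef (p w : R) : 1 < p -> 0 < w ->
  (w `^ (p - 1)^-1) `^ p = w `^ (p - 1)^-1 * (w `^ 2^-1) ^+ 2.
Proof.
move=> p1 w0; rewrite powR_half_sqr // -powRrM.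
rewrite -powRS //.
by congr (_ `^ _); field; lra.
Qed.

(** This is the origin of [e_np]: the exponent is [2/(p-1) - n/2]. *)
Lemma rescale_intsq_coef n (p w : R) : 1 < p -> 0 < w ->
  (w `^ (p - 1)^-1) ^+ 2 * (w `^ 2^-1)^-1 ^+ n = (w `^ e_np n p)^-1.
Proof.
move=> p1 w0; rewrite -!powRN -!powR_mulrn ?powR_ge0 // -!powRrM.
rewrite -powRD ?(gt_eqF w0) ?implybT //.
by congr (_ `^ _); rewrite /e_np; field; lra.
Qed.

Lemma rescaleK n (p w : R) (A : 'rV[R]_n -> R) : 0 < w ->
  rescale p w (rescale p w^-1 A) = A.
Proof.
move=> w0; apply/funext => x; rewrite /rescale /dilate scalerA mulrA.
rewrite -!powRM ?invr_ge0 ?ltW // mulVf ?mulfV ?gt_eqF //.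
by rewrite !powR1 scale1r mul1r.
Qed.

(** Values at the origin already separate the dilates, so distinct roots give distinct solutions. *)
Lemma rescale_inj n (p w1 w2 : R) (A : 'rV[R]_n -> R) : 1 < p -> 0 < w1 -> 0 < w2 ->
  0 < A 0 -> rescale p w1 A = rescale p w2 A -> w1 = w2.
Proof.
move=> p1 w10 w20 A0 /(congr1 (@^~ 0)); have A0' : A 0 != 0 by rewrite gt_eqF.
have q0 : 0 < (p - 1)^-1 by rewrite invr_gt0 subr_gt0.
rewrite /rescale /dilate !scaler0 => /(mulIf A0').
by apply: (powR_injective q0); rewrite nnegrE ltW.
Qed.
End Scaling.

(** * Roots of [f_np] *)

Section Counting.
Context {R : realType}.
Implicit Types (n : nat) (p w K : R).

Lemma powR_subr1 (w e : R) : 0 < w -> w `^ e = w `^ (e - 1) * w.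
Proof. by move=> w0; rewrite -powRS // subrK. Qed.

(** The sign of the derivative is that of an affine function of [w], from which every monotonicity
    statement below follows. *)
Lemma f_np_drv n p w : 0 < w -> is_derive w 1 (f_np n p)
  (w `^ (e_np n p - 1) * ((e_np n p + 1) * w - e_np n p)).
Proof.
move=> w0; set e := e_np n p.
have h := drvM (drvB (drv_id w) (drv_cst 1 w)) (drv_powR e w0 (drv_id w)).
by apply: is_derive_eq h _; rewrite (powR_subr1 e w0); ring.
Qed.

Lemma f_np_IVT n p K (a b : R) : 0 < a -> a <= b ->
  Num.min (f_np n p a) (f_np n p b) <= K <= Num.max (f_np n p a) (f_np n p b) ->
  exists2 w, a <= w <= b & f_np n p w = K.
Proof.
move=> a0 ab H; have [|w] := IVT ab _ H; last by rewrite in_itv; exists w.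
apply: derivable_within_continuous => x; rewrite in_itv /= => /andP[ax _].
by have [] := f_np_drv n p (lt_le_trans a0 ax).
Qed.

Lemma f_np1 n p : f_np n p 1 = 0.
Proof. by rewrite /f_np subrr mul0r. Qed.

Lemma f_np_incr n p (b : R) :
  (forall w, 1 < w < b -> 0 < (e_np n p + 1) * w - e_np n p) ->
  forall x y, 1 <= x -> x < y -> y <= b -> f_np n p x < f_np n p y.
Proof.
move=> H x y x1 xy yb.
apply: (drv_lt xy) => z /andP[xz zy].
  by apply: f_np_drv; exact: lt_le_trans (lt_le_trans ltr01 x1) xz.
have z1 := le_lt_trans x1 xz.
apply: mulr_gt0; first by rewrite powR_gt0 // (lt_trans ltr01).
by apply: H; rewrite z1 (lt_le_trans zy).
Qed.

Lemma f_np_decr n p (a : R) : 0 < a ->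
  (forall w, a < w -> (e_np n p + 1) * w - e_np n p < 0) ->
  forall x y, a <= x -> x < y -> f_np n p y < f_np n p x.
Proof.
move=> a0 H x y ax xy; rewrite -ltrN2.
apply: (@drv_lt R (fun w => - f_np n p w)
  (fun w => - (w `^ (e_np n p - 1) * ((e_np n p + 1) * w - e_np n p))) _ _ xy)
  => z /andP[xz zy].
  by apply/drvN/f_np_drv; exact: lt_le_trans (lt_le_trans a0 ax) xz.
have az := le_lt_trans ax xz.
by rewrite oppr_gt0 pmulr_rlt0 ?H // powR_gt0 // (lt_trans a0).
Qed.

Lemma f_np_root_unique n p K : 0 < e_np n p + 1 -> 0 < K ->
  exists2 w1, 1 < w1 & forall w, 1 < w -> f_np n p w = K <-> w = w1.
Proof.
move=> e0 K0; set e := e_np n p in e0.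
have H w : 1 < w -> 0 < (e + 1) * w - e.
  by move=> w1; have := mulr_gt0 e0 (_ : 0 < w - 1); rewrite subr_gt0 => /(_ w1); lra.
have inc x y : 1 <= x -> x < y -> f_np n p x < f_np n p y.
  by move=> x1 xy; apply: (@f_np_incr n p y) => // w /andP[/H].
(* For [W >= 2] one has [W - 1 >= W/2], so [f W >= W^(e+1) / 2], and the second entry makes this at
   least [K]. *)
pose W := Num.max 2 ((2 * K) `^ (e + 1)^-1).
have W2 : 2 <= W by rewrite le_max lexx.
have W0 : 0 < W by lra.
have KW : K <= f_np n p W.
  have h : 2 * K <= W `^ (e + 1).
    have : (2 * K) `^ (e + 1)^-1 <= W by rewrite le_max lexx orbT.
    move=> /(ge0_ler_powR (ltW e0)); rewrite !nnegrE => /(_ (powR_ge0 _ _) (ltW W0)).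
    by rewrite -powRrM mulVf ?gt_eqF // powRr1 // mulr_ge0 // ltW.
  rewrite /f_np -/e; move: h; rewrite (powR_subr1 (e + 1) W0) addrK => h.
  have : 0 <= (W - 2) * W `^ e by rewrite mulr_ge0 ?powR_ge0 ?subr_ge0.
  lra.
have [|||w /andP[w1 wW] fw] := @f_np_IVT n p K 1 W => //; first by lra.
  rewrite f_np1 ge_min (ltW K0) /= le_max KW orbT //.
have w1' : 1 < w.
  rewrite lt_neqAle w1 andbT; apply: contraTneq K0 => e1.
  by rewrite -fw -e1 f_np1 ltxx.
exists w => // x x1; split=> [fx|->//].
case: (ltgtP x w) => // h; [have := inc _ _ (ltW x1) h|have := inc _ _ w1 h].
all: by rewrite fx fw ltxx.
Qed.

Lemma f_np_critical n p w : e_np n p = -1 -> 0 < w -> f_np n p w = 1 - w^-1.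
Proof.
move=> e1 w0; rewrite /f_np e1 powR_inv1 ?ltW //.
by field; rewrite gt_eqF.
Qed.

Section Subcritical.
Context (n : nat) (p : R) (e0 : e_np n p + 1 < 0).
Let ws := omega_np n p.

Lemma omega_np_gt1 : 1 < ws.
Proof. by move: e0; rewrite /ws /omega_np => ?; rewrite ltr_pdivlMr; lra. Qed.

(** [ws] is the zero of the affine factor of the derivative, hence the point where [f_np] peaks. *)
Lemma omega_npE : (e_np n p + 1) * ws = e_np n p.
Proof. rewrite /ws /omega_np; field; rewrite gt_eqF //; move: e0; lra. Qed.

Lemma f_np_incr_omega x y : 1 <= x -> x < y -> y <= ws -> f_np n p x < f_np n p y.
Proof.
apply: f_np_incr => w /andP[_ ww].
have := nmulr_rgt0 (w - ws) e0; rewrite subr_lt0 ww => h.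
have : 0 < (e_np n p + 1) * (w - ws) by rewrite h.
by rewrite mulrBr omega_npE.
Qed.

Lemma f_np_decr_omega x y : ws <= x -> x < y -> f_np n p y < f_np n p x.
Proof.
apply: f_np_decr; first exact: lt_trans omega_np_gt1.
move=> w ww; rewrite -{2}omega_npE -mulrBr nmulr_rlt0 // subr_gt0 //.
Qed.

Lemma f_np_le_omega w : 1 < w -> f_np n p w <= f_np n p ws.
Proof.
move=> w1; case: (ltgtP w ws) => [h|h|->//]; apply: ltW.
- exact: f_np_incr_omega (ltW w1) h (lexx _).
- exact: f_np_decr_omega h.
Qed.

Lemma f_np_eq_omega w : 1 < w -> f_np n p w = f_np n p ws <-> w = ws.
Proof.
move=> w1; split=> [fw|->//]; case: (ltgtP w ws) => // h.
- by have := f_np_incr_omega (ltW w1) h (lexx _); rewrite fw ltxx.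
- by have := f_np_decr_omega (lexx _) h; rewrite fw ltxx.
Qed.

(** There is one root on each side of the peak: [f_np] rises from zero at 1 and falls below any
    positive level at infinity. *)
Lemma f_np_two_roots K : 0 < K -> K < f_np n p ws ->
  exists w1 w2, [/\ 1 < w1, 1 < w2, w1 <> w2 &
    forall w, 1 < w -> f_np n p w = K <-> w = w1 \/ w = w2].
Proof.
move=> K0 Kf; have ws1 := omega_np_gt1.
pose s := - (e_np n p + 1).
have s0 : 0 < s by rewrite oppr_gt0.
(* Since [f W < W^(e+1) = W^(-s)], the second entry pushes [f W] below [K]. *)
pose W := Num.max ws (K^-1 `^ s^-1).
have wW : ws <= W by rewrite le_max lexx.
have W1 := lt_le_trans ws1 wW; have W0 : 0 < W by lra.
have KW : f_np n p W < K.
  have h : K^-1 <= W `^ s.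
    have : K^-1 `^ s^-1 <= W by rewrite le_max lexx orbT.
    move=> /(ge0_ler_powR (ltW s0)); rewrite !nnegrE => /(_ (powR_ge0 _ _) (ltW W0)).
    by rewrite -powRrM mulVf ?gt_eqF // powRr1 // invr_ge0 ltW.
  have h2 : W `^ (e_np n p + 1) <= K.
    rewrite -[_ + 1]opprK powRN -[X in _ <= X]invrK lef_pV2 ?posrE ?invr_gt0 ?powR_gt0 //.
  apply: lt_le_trans h2; rewrite (powR_subr1 (_ + 1) W0) addrK /f_np mulrC.
  by rewrite ltr_pM2l ?powR_gt0 // ltrBlDr ltrDl.
have [|||w1 /andP[w11 w1s] f1] := @f_np_IVT n p K 1 ws => //; first exact: ltW.
  by rewrite f_np1 ge_min (ltW K0) /= le_max (ltW Kf) orbT.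
have [|||w2 /andP[w2s w2W] f2] := @f_np_IVT n p K ws W => //; first by lra.
  by rewrite ge_min (ltW KW) orbT /= le_max (ltW Kf).
have w1' : 1 < w1.
  rewrite lt_neqAle w11 andbT; apply: contraTneq K0 => e1.
  by rewrite -f1 -e1 f_np1 ltxx.
have w1l : w1 < ws.
  by rewrite lt_neqAle w1s andbT; apply: contraTneq Kf => <-; rewrite f1 ltxx.
have w2l : ws < w2.
  by rewrite lt_neqAle w2s andbT; apply: contraTneq Kf => ->; rewrite f2 ltxx.
exists w1, w2; split=> //; first by lra.
  by move=> e; move: w1l w2l; rewrite e; lra.
move=> w w_gt1; split=> [fw|[] -> //].
have [h|h] := leP w ws.
- left; case: (ltgtP w w1) => // h1.
    by have := f_np_incr_omega (ltW w_gt1) h1 w1s; rewrite fw f1 ltxx.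
  by have := f_np_incr_omega w11 h1 h; rewrite fw f1 ltxx.
- right; case: (ltgtP w w2) => // h1.
    by have := f_np_decr_omega (ltW h) h1; rewrite fw f2 ltxx.
  by have := f_np_decr_omega w2s h1; rewrite fw f2 ltxx.
Qed.
End Subcritical.
End Counting.

(** * Solutions of (P) as dilates of the ground state *)

Section Classification.
Context {R : realType}.

Lemma solution_int_sq_gt0 n (p k : R) (A : 'rV[R]_n -> R) :
  is_solution n p k A -> 0 < fine (int_sq A).
Proof.
move=> [A0 [_ [[cA _ _ _ _] [fin _]]]].
by apply: fine_gt0; rewrite fin andbT; exact: int_sq_gt0.
Qed.

(** Dilating by [w^-1] turns the total linear coefficient [1 + k \int A^2 = w] into 1, which is the
    equation with [k = 0]. *)
Lemma normalize_solution n (p k w : R) (A : 'rV[R]_n -> R) : 1 < p -> 0 < w ->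
  w = 1 + k * fine (int_sq A) -> is_solution n p k A ->
  is_solution n p 0 (rescale p w^-1 A).
Proof.
move=> p1 w0 wE S; have wi0 : 0 < w^-1 by rewrite invr_gt0.
apply: (is_solution_dilate _ _ _ S); rewrite ?powR_gt0 ?rescale_coef //.
by rewrite powR_half_sqr // -wE mulVf ?gt_eqF // mul0r addr0.
Qed.

Lemma solution_classification n (p k : R) (A0 : 'rV[R]_n.+1 -> R) :
  1 < p -> 0 < k -> (n%:R - 1) * p < n%:R + 3 -> is_solution n.+1 p 0 A0 ->
  forall A, is_solution n.+1 p k A <-> exists w, [/\ 1 < w,
    f_np n.+1 p w = k * fine (int_sq A0) & A = rescale p w A0].
Proof.
move=> p1 k0 sub S0 A; split=> [S|[w [w1 fw ->]]].
  have I0 := solution_int_sq_gt0 S.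
  pose w := 1 + k * fine (int_sq A).
  have w1 : 1 < w by rewrite ltrDl mulr_gt0.
  have w0 := lt_trans ltr01 w1.
  (* Uniqueness identifies the normalized solution with [A0]; undoing the dilation recovers [A]. *)
  have AE : A = rescale p w A0.
    rewrite (solution0_unique p1 sub S0 (normalize_solution p1 w0 erefl S)).
    by rewrite rescaleK.
  exists w; split=> //.
  have e0 : 0 < w `^ e_np n.+1 p by exact: powR_gt0.
  have : w - 1 = k * fine (int_sq A) by rewrite /w; ring.
  have fin0 : int_sq A0 \is a fin_num.
    by have [_ [_ [_ [fin _]]]] := S0; rewrite ge0_fin_numE ?int_sq_ge0.
  (* Substituting [\int A^2 = w^(-e) \int A0^2] into [w - 1 = k \int A^2] gives the root
     equation. *)
  have -> : int_sq A = ((w `^ e_np n.+1 p)^-1%:E * int_sq A0)%E.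
    by rewrite {1}AE /rescale int_sq_dilation ?powR_gt0 // rescale_intsq_coef.
  by rewrite fineM // /f_np => ->; rewrite /= -mulrA mulrAC mulVf ?mul1r // gt_eqF.
have w0 := lt_trans ltr01 w1.
apply: (is_solution_dilate _ _ _ S0); rewrite ?powR_gt0 ?rescale_coef //.
rewrite rescale_intsq_coef // powR_half_sqr // mul0r addr0 mulr1.
rewrite mulrCA -fw /f_np mulrC mulrK; first by ring.
by rewrite unitfE gt_eqF ?powR_gt0.
Qed.

(** The sign of [e_np + 1], which governs the shape of [f_np], is thus that of [p - (1 + 4/(n+2))]:
    this separates the first three cases. *)
Lemma e_npE n (p : R) : 1 < p ->
  e_np n p + 1 = (n%:R + 2) / 2 * (p - (1 + 4 / (n%:R + 2))) / (p - 1).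
Proof.
move=> p1; have n2 : n%:R + 2 != 0 :> R by rewrite gt_eqF // ltr_wpDl.
have p10 : p - 1 != 0 by rewrite gt_eqF // subr_gt0.
by rewrite /e_np; field; rewrite n2 p10.
Qed.
End Classification.

(** Parameter zero turns [is_solution] into the ground state equation. Finiteness of the integral is
    part of [is_solution], so [fine] loses nothing in [alpha]. *)
Theorem theorem2 (R : realType) (n : nat) (p k : R) :
  (1 <= n)%N -> 1 < p -> 0 < k ->
  (* p < p^*(n) *)
  let subcrit := (n <= 2)%N \/ p < (n%:R + 2) / (n%:R - 2) in
  (forall A0 : 'rV[R]_n -> R, subcrit -> is_solution n p 0 A0 ->
   let alpha := fine (int_sq A0) in
   (* case 1 *)
   (p < 1 + 4 / (n%:R + 2) ->
      (f_np n p (omega_np n p) / alpha < k -> forall A, ~ is_solution n p k A) /\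
      (k = f_np n p (omega_np n p) / alpha ->
         exists A1, forall A, is_solution n p k A <-> A = A1) /\
      (k < f_np n p (omega_np n p) / alpha ->
         exists A1 A2, A1 <> A2 /\
           forall A, is_solution n p k A <-> (A = A1 \/ A = A2))) /\
   (* case 2 *)
   (p = 1 + 4 / (n%:R + 2) ->
      (1 / alpha <= k -> forall A, ~ is_solution n p k A) /\
      (k < 1 / alpha -> exists A1, forall A, is_solution n p k A <-> A = A1)) /\
   (* case 3 *)
   (1 + 4 / (n%:R + 2) < p ->
      exists A1, forall A, is_solution n p k A <-> A = A1)) /\
  (* case 4: p >= p^*(n) *)
  (~ subcrit -> forall A : 'rV[R]_n -> R, ~ is_solution n p k A).
Proof.
case: n => [//|n] _ p1 k0 subcrit; split; last first.
  move=> /not_orP[n2 pn] A S.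
  have n2' : (2 <= n)%N by rewrite leqNgt; apply/negP => ?; apply: n2.
  have nR : (2 : R) <= n%:R by rewrite ler_nat.
  have I0 := solution_int_sq_gt0 S.
  have w0 : 0 < 1 + k * fine (int_sq A) by rewrite addr_gt0 // mulr_gt0.
  apply: (no_supercritical_solution p1 _ (normalize_solution p1 w0 erefl S)).
  move/negP: pn; rewrite -leNgt -natr1 ler_pdivrMr; last by lra.
  by lra.
move=> A0 sub S0 alpha.
(* The dimension is now [n.+1], so [p < p^*] reads this way with [d = n]. In dimensions one and two
   the left side is nonpositive and every [p] qualifies. *)
have sub' : (n%:R - 1) * p < n%:R + 3.
  have [n1|n2] := leqP n 1.
    have : (n%:R : R) <= 1 by rewrite (ler_nat _ n 1).
    have : 0 <= (n%:R : R) by [].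
    nra.
  have nR : (2 : R) <= n%:R by rewrite ler_nat.
  case: sub => [|]; first by rewrite ltnNge n2.
  by rewrite -natr1 ltr_pdivlMr; lra.
have a0 : 0 < alpha := solution_int_sq_gt0 S0.
have K0 : 0 < k * alpha by rewrite mulr_gt0.
have cls := solution_classification p1 k0 sub' S0.
(* By the classification, a single root above 1 means a single solution. *)
have one w1 : 1 < w1 -> (forall w, 1 < w -> f_np n.+1 p w = k * alpha <-> w = w1) ->
    exists A1, forall A, is_solution n.+1 p k A <-> A = A1.
  move=> w11 H; exists (rescale p w1 A0) => A; rewrite cls; split.
    by move=> [w [w_gt1 /(H _ w_gt1) -> ->]].
  by move=> ->; exists w1; split=> //; apply/H.
have n20 : 0 < (n.+1%:R + 2 : R) / 2 by rewrite divr_gt0 // addr_gt0.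
have ip0 : 0 < (p - 1)^-1 by rewrite invr_gt0 subr_gt0.
split=> [pl|]; last split=> [pe|pg].
- have e0 : e_np n.+1 p + 1 < 0.
    by rewrite e_npE // pmulr_llt0 // pmulr_rlt0 // subr_lt0.
  split; last split.
  + rewrite ltr_pdivrMr // => lt A /cls[w [w1 fw _]].
    by have := f_np_le_omega e0 w1; rewrite fw leNgt lt.
  + move=> kE; have kf : f_np n.+1 p (omega_np n.+1 p) = k * alpha.
      by rewrite kE divfK // gt_eqF.
    apply: (one _ (omega_np_gt1 e0)) => w w1; rewrite -kf; exact: f_np_eq_omega.
  + rewrite ltr_pdivlMr // => /(f_np_two_roots e0 K0).
    move=> [w1 [w2 [w11 w21 w12 H]]].
    exists (rescale p w1 A0), (rescale p w2 A0); split.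
      move=> /(rescale_inj p1 (lt_trans ltr01 w11) (lt_trans ltr01 w21) _) e.
      by apply/w12/e; have [] := S0.
    move=> A; rewrite cls; split.
      move=> [w [w_gt1 /(H _ w_gt1)[] -> ->]]; [by left|by right].
    move=> [] ->; [exists w1|exists w2]; split=> //; apply/H => //; [by left|by right].
- have e1 : e_np n.+1 p = -1.
    apply/eqP; rewrite -addr_eq0 e_npE // {1}pe; apply/eqP; ring.
  split.
    (* Here [f w = 1 - 1/w] stays below 1. *)
    rewrite ler_pdivrMr // => le A /cls[w [w1 + _]]; have w0 := lt_trans ltr01 w1.
    rewrite f_np_critical // => fw.
    have : 0 < w^-1 by rewrite invr_gt0.
    rewrite -/alpha in fw; lra.
  rewrite ltr_pdivlMr // => lt.
  have K1 : 0 < 1 - k * alpha by rewrite subr_gt0.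
  (* This solves [1 - 1/w = k alpha]; it exceeds 1 because [0 < k alpha < 1]. *)
  apply: (one (1 - k * alpha)^-1).
    by rewrite invf_gt1 //; lra.
  move=> w w1; rewrite f_np_critical //; last exact: lt_trans w1.
  split=> [fw|->]; last by rewrite invrK; lra.
  by rewrite -fw subKr invrK.
- have e0 : 0 < e_np n.+1 p + 1.
    by rewrite e_npE // pmulr_lgt0 // pmulr_rgt0 // subr_gt0.
  have [w1 w11 H] := f_np_root_unique e0 K0.
  exact: one w11 H.
Qed.
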